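(* Let $(\mathcal X,d,\mu)$ be a metric measure space with the volume doubling property, let $R>0$, $1\le p<\infty$ and let $v$ be a weight on $\mathcal X$. Suppose $v\in D_p^{\mathcal M}$, i.e. $v^{-1/p}\in L^{p'}_{\rm loc}(\mathcal X)$. Then there exists a weight $u$ such that the operator $\mathcal M^{\mathcal X}_R$ maps $L^p_v(\mathcal X)$ into $L^p_u(\mathcal X)$ if $p>1$, and maps $L^1_v(\mathcal X)$ into weak $L^1_u(\mathcal X)$ if $p=1$. Conversely, for $1\le p<\infty$, if $\int_{B(0,r)}v\,d\mu<\infty$ for all $r>0$ and the operator $\mathcal A_R$ maps $L^p_v(\mathcal X)$ into weak $L^p_u(\mathcal X)$ for some weight $u$, then $v^{-1/p}\in L^{p'}_{\rm loc}(\mathcal X)$.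
   Context: Metric measure space with volume doubling: $(\mathcal X,d)$ is a locally compact separable metric space, $\mu$ a Radon measure with $0<\mu(B(x,r))<\infty$ for all balls $B(x,r)=\{y:d(x,y)<r\}$, and there is $C>0$ with $\mu(B(x,2r))\le C\mu(B(x,r))$ for all $x\in\mathcal X$, $r>0$. $0$ denotes a fixed point of $\mathcal X$. A weight is a measurable function $v:\mathcal X\to(0,\infty)$ such that $v\,d\mu$ is a Radon measure. $\|f\|_{L^p_v(\mathcal X)}=(\int_{\mathcal X}|f|^pv\,d\mu)^{1/p}$; weak $L^p_u$ is given by the quasinorm $\sup_{\lambda>0}\lambda\left(\int_{\{|f|>\lambda\}}u\,d\mu\right)^{1/p}$. ''Maps $A$ into $B$'' means bounded: there is a constant $C$ with $\|\cdot\|_B$ of the image at most $C\|f\|_A$ for all $f\in A$. $\frac1p+\frac1{p'}=1$, and $f\in L^{q}_{\rm loc}(\mathcal X)$ means $f\chi_{B(0,r)}\in L^q(\mathcal X)$ for all $r>0$. $\mathcal A_rf(x)=\frac1{\mu(B(x,r))}\int_{B(x,r)}|f(y)|\,d\mu(y)$ and $\mathcal M^{\mathcal X}_Rf(x)=\sup_{0<r<R}\mathcal A_rf(x)$. *)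

(* Defs.v *)
From HB Require Import structures.
From mathcomp Require Import all_boot all_order all_algebra.
From mathcomp Require Import all_classical all_reals all_analysis measurable_realfun.

Set Implicit Arguments.
Unset Strict Implicit.
Unset Printing Implicit Defensive.

Import Order.TTheory GRing.Theory Num.Theory.
Import numFieldNormedType.Exports.

Local Open Scope classical_set_scope.
Local Open Scope ring_scope.

(* The library builds generated sigma-algebras over pointed types only.  The
   chosen point plays no role here except that it makes the space nonempty. *)
#[short(type="pmetricType")]
HB.structure Definition PMetric (K : numDomainType) :=
  { M of Metric K M & Pointed M }.

Definition borelType (R : realType) (X : pmetricType R) :=
  g_sigma_algebraType (@open X).

Section spaces.
Context (R : realType) (X : pmetricType R).
Implicit Types (nu : set X -> \bar R) (mu : {measure set (borelType X) -> \bar R}).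
Local Open Scope ereal_scope.

Definition separable := exists2 D : set X, countable D & dense D.

(* A Borel measure that is finite on compact sets, outer regular on Borel sets
   and inner regular on open sets.  [nu] is a bare set function so that the
   definition applies to [v dmu] as well. *)
Definition radon nu :=
  [/\ forall A : set X, compact A -> nu A < +oo,
      forall A : set X, (@measurable _ (borelType X)) A ->
        nu A = ereal_inf [set nu U | U in [set U | open U /\ A `<=` U]] &
      forall U : set X, open U ->
        nu U = ereal_sup [set nu A | A in [set A | compact A /\ A `<=` U]]].

Definition doubling mu :=
  exists2 C : R, (0 < C)%R & forall (x : X) (r : R), (0 < r)%R ->
    mu (ball x (2 * r)%R) <= C%:E * mu (ball x r).

Record doubling_metric_measure_space mu : Prop := {
  dmms_locally_compact : locally_compact [set: X] ;
  dmms_separable : separable ;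
  dmms_radon : radon mu ;
  dmms_ball : forall (x : X) (r : R), (0 < r)%R -> 0 < mu (ball x r) < +oo ;
  dmms_doubling : doubling mu
}.

Definition weight mu (v : borelType X -> R) :=
  [/\ forall x, (0 < v x)%R,
      measurable_fun [set: borelType X] v &
      radon (fun A => \int[mu]_(x in A) (v x)%:E)].

Definition wLnorm mu (p : R) (v : borelType X -> R) (f : borelType X -> \bar R) :=
  (\int[mu]_x (`|f x| `^ p * (v x)%:E)) `^ p^-1.

Definition weak_wLnorm mu (p : R) (v : borelType X -> R)
    (f : borelType X -> \bar R) :=
  ereal_sup [set l%:E *
      (\int[mu]_(x in [set x | l%:E < `|f x|]) (v x)%:E) `^ p^-1
    | l in [set l : R | (0 < l)%R]].

(* Boundedness of [T] from the space with (quasi)norm [NA] to the one with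
   (quasi)norm [NB]; the members of these spaces are the measurable functions
   of finite (quasi)norm, and the bound makes [NB (T f)] finite.  The images are
   extended-real valued because averages may a priori be infinite. *)
Definition maps_into (NA NB : (borelType X -> \bar R) -> \bar R)
    (T : (borelType X -> R) -> borelType X -> \bar R) :=
  exists C : R, forall f : borelType X -> R,
    measurable_fun [set: borelType X] f -> NA (EFin \o f) < +oo ->
    measurable_fun [set: borelType X] (T f) /\
    NB (T f) <= C%:E * NA (EFin \o f).

Definition Lloc mu (x0 : X) (q : \bar R) (f : borelType X -> R) :=
  forall r : R, (0 < r)%R -> (f \* \1_(ball x0 r))%R \in Lfun mu q.

(* [x0] is the base point written 0 in the definition of local integrability;
   the conjugate exponent of 1 is +oo, with the essential supremum norm. *)
Definition DpM mu (x0 : X) (p : R) (v : borelType X -> R) :=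
  Lloc mu x0 (hoelder_conjugate p%:E) (fun x => v x `^ (- p^-1))%R.

Definition average mu (r : R) (f : borelType X -> R) (x : borelType X) :=
  (mu (ball (x : X) r))^-1 * \int[mu]_(y in ball (x : X) r) `|(f y)%:E|.

Definition local_maximal mu (rho : R) (f : borelType X -> R)
    (x : borelType X) :=
  ereal_sup [set average mu r f x | r in [set r : R | (0 < r < rho)%R]].

End spaces.

(* Main.v *)
(** The local maximal operator [M] is of weak type (1,1) because [mu] is doubling
    (finite Vitali covering, inner regularity of [mu] on open sets).

    Sufficiency, [p > 1].  Let [s = v^(-1/(p-1))], which is locally integrable, so
    that [M s] is finite a.e., and let [H = max(1, M s)].  The sublinear operator
    [g |-> M (g s) / H] is bounded from [L^oo] to [L^oo] (as [M s <= H]) and from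
    [L^1(s dmu)] to weak [L^1(mu)] (as [H >= 1]); interpolation makes it bounded
    from [L^p(s dmu)] to [L^p(mu)].  With [f = g s] this is the estimate for the
    weight [u = H^(-p)].

    Sufficiency, [p = 1].  [1/v] is essentially bounded on balls, so the weak type
    inequality may be applied annulus by annulus around [x0], with a weight that
    is constant and small enough on each annulus.

    In both cases [u <= 1], whence [u dmu] inherits the regularity of [mu].

    Necessity.  On a ball [B] of radius [rho/2], testing the weak inequality yields
    [int_B |f| <= K (int |f|^p v)^(1/p)]; take for [f] truncations of [s] if [p > 1]
    and indicators of the sets where [v] is small if [p = 1].  By doubling every
    ball is covered by finitely many balls of radius [rho/2]. *)

Require Import Defs.
From HB Require Import structures.
From mathcomp Require Import all_boot all_order all_algebra.
From mathcomp Require Import all_classical all_reals all_analysis measurable_realfun.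
From mathcomp Require Import ess_sup_inf ring lra.

Set Implicit Arguments.
Unset Strict Implicit.
Unset Printing Implicit Defensive.

Import Order.TTheory GRing.Theory Num.Theory.
Import numFieldNormedType.Exports.

Local Open Scope classical_set_scope.
Local Open Scope ring_scope.

(** * Extended real numbers: order, powers and series *)

Section ereal_preliminaries.
Context (R : realType).
Local Open Scope ereal_scope.

Lemma measurable_set_lt d (T : measurableType d) (F G : T -> \bar R) :
  measurable_fun setT F -> measurable_fun setT G ->
  measurable [set x | F x < G x].
Proof. by move=> mF mG; rewrite -[X in measurable X]setTI; exact: measurable_lte. Qed.

Lemma lt_EFin_dense (a : R) (b : \bar R) : a%:E < b ->
  exists2 z : R, (a < z)%R & z%:E < b.
Proof.
case: b => [b| |]//; last by move=> _; exists (a + 1)%R; rewrite ?ltrDl// ltry.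
by rewrite lte_fin => ab; exists ((a + b) / 2)%R; rewrite ?lte_fin midf_lt.
Qed.

Lemma ge0_le_poweR (r : R) (x y : \bar R) : (0 <= r)%R -> 0 <= x -> x <= y ->
  x `^ r <= y `^ r.
Proof.
move=> r0 x0 xy; apply: gt0_ler_poweR => //; rewrite in_itv/= leey andbT//.
exact: le_trans xy.
Qed.

Lemma nneseries_term_le (u : nat -> \bar R) j : (forall i, 0 <= u i) ->
  u j <= \sum_(i <oo) u i.
Proof.
move=> u0; apply: le_trans (nneseries_lim_ge j.+1 (fun i _ _ => u0 i)).
by rewrite big_nat_recr//= leeDr// sume_ge0.
Qed.

End ereal_preliminaries.

(** * Balls of a metric space and their Borel measurability *)

Section metric_balls.
Context (R : realType) (X : pmetricType R).
Implicit Types (x y z : X) (r s : R).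

Lemma ball_mdistP x r y : ball x r y <-> mdist x y < r.
Proof. by rewrite ballEmdist. Qed.

Lemma subset_ball_mdist x y r s : mdist x y + r <= s -> ball y r `<=` ball x s.
Proof.
move=> h z /ball_mdistP yz; apply/ball_mdistP.
by have := metric_triangle x y z; lra.
Qed.

Lemma open_ballP (U : set X) :
  (forall x, U x -> exists2 e, 0 < e & ball x e `<=` U) -> open U.
Proof. by move=> h; rewrite openE => x /h[e e0 eU]; apply/nbhs_ballP; exists e. Qed.

Lemma metric_ball_open x r : open (ball x r).
Proof.
apply: open_ballP => y /ball_mdistP xy.
exists (r - mdist x y); first by rewrite subr_gt0.
by apply: subset_ball_mdist; rewrite addrC subrK.
Qed.

Lemma measurable_open (U : set X) :
  open U -> (@measurable _ (borelType X)) U.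
Proof. by move=> oU; exact: sub_sigma_algebra. Qed.

Lemma measurable_compact (K : set X) :
  compact K -> (@measurable _ (borelType X)) K.
Proof.
move=> cK; rewrite -[K]setCK; apply: measurableC; apply: measurable_open.
by apply: closed_openC; apply: compact_closed => //; exact: metric_hausdorff.
Qed.

Lemma measurable_metric_ball x r : (@measurable _ (borelType X)) (ball x r).
Proof. by apply: measurable_open; exact: metric_ball_open. Qed.

Lemma bigcup_inner_ball x r : \bigcup_n ball x (r - n.+1%:R^-1) = ball x r.
Proof.
apply/seteqP; split => y; first by move=> [n _]; apply: le_ball; rewrite gerBl.
move/ball_mdistP; rewrite -subr_gt0 => /ltr_add_invr[n]; rewrite add0r => hn.
by exists n => //; apply/ball_mdistP; rewrite ltrBrDl -ltrBrDr.
Qed.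

Lemma bigcup_ball_nat x : \bigcup_n ball x n%:R = [set: X].
Proof.
apply/seteqP; split => // y _; exists (Num.trunc (mdist x y)).+1 => //.
exact/ball_mdistP/truncnS_gt.
Qed.

End metric_balls.

(** * Inner approximation of ball integrals *)

Section inner_ball_integral.
Context (R : realType) (X : pmetricType R).
Variable mu : {measure set (borelType X) -> \bar R}.
Local Open Scope ereal_scope.

(** An open ball is the increasing union of the balls of radius [r - 1/(n+1)], so monotone
    convergence applies. This gives both the measurability of averages and the reduction of the
    maximal function to rational radii. *)
Lemma lt_integral_inner_ball (g : borelType X -> \bar R) (x : X) (r : R)
    (a : \bar R) : measurable_fun setT g -> (forall y, 0 <= g y) ->
  a < \int[mu]_(y in ball x r) g y ->
  exists2 e : R, (0 < e)%R & a < \int[mu]_(y in ball x (r - e)) g y.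
Proof.
move=> mg g0; rewrite -bigcup_inner_ball => alt.
have nd : nondecreasing_seq (fun n => ball x (r - n.+1%:R^-1)%R : set (borelType X)).
  move=> m n mn; rewrite subsetEset; apply: le_ball.
  by rewrite lerB// lef_pV2 ?posrE// ler_nat.
have := @ge0_nondecreasing_set_cvg_integral _ _ _ _ g mu nd
  (fun n => measurable_metric_ball _ _) (fun n => measurable_funTS mg) (fun n y _ => g0 y).
move=> ic.
have := ic => /(_ [set y | a < y])%classic.
have /open_nbhs_nbhs/[swap]/[apply] : open_nbhs (\int[mu]_(y in \bigcup_n ball x (r - n.+1%:R^-1)%R) g y) [set y | a < y].
  by split => //; exact: open_ereal_gt_ereal.
move=> [n _ /(_ n)/=]; rewrite leqnn => /(_ isT) h.
by exists (n.+1%:R^-1)%R.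
Qed.

End inner_ball_integral.

(** * Consequences of doubling: Vitali covering and measurability of averages *)

Section doubling_space.
Context (R : realType) (X : pmetricType R).
Variable mu : {measure set (borelType X) -> \bar R}.
Hypothesis hX : doubling_metric_measure_space mu.
Local Open Scope ereal_scope.

Lemma mu_ball_fin_num (x : X) (r : R) : mu (ball x r) \is a fin_num.
Proof.
rewrite ge0_fin_numE//; have [r0|r0] := ltP 0%R r.
  by have /andP[] := dmms_ball hX x r0.
rewrite (_ : ball x r = set0 :> set X) ?measure0//.
apply/seteqP; split=> // y /ball_mdistP; have := mdist_ge0 x y.
by move=> h1 h2; have := lt_le_trans h2 r0; rewrite ltNge h1.
Qed.

Lemma mu_ball_gt0 (x : X) (r : R) : (0 < r)%R -> (0 < fine (mu (ball x r)))%R.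
Proof. by move=> r0; rewrite fine_gt0//; exact: dmms_ball. Qed.

Lemma doubling_pow n : exists2 C : R, (0 < C)%R &
  forall (x : X) (r : R), (0 < r)%R ->
    mu (ball x (2 ^+ n * r)%R) <= C%:E * mu (ball x r).
Proof.
have [C C0 HC] := dmms_doubling hX; exists (C ^+ n)%R; first exact: exprn_gt0.
elim: n => [|n IH] x r r0; first by rewrite !expr0 mul1r mul1e.
rewrite exprS -mulrA exprS EFinM -muleA.
apply: (le_trans (HC _ _ _)); first by rewrite mulr_gt0// exprn_gt0.
by rewrite lee_pmul2l// IH.
Qed.

Lemma compact_ball_cover (K : set X) (P : set (X * R)) :
  compact K -> K `<=` \bigcup_(b in P) ball b.1 b.2 ->
  exists s : seq (X * R), (forall b, b \in s -> P b) /\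
    K `<=` \bigcup_(b in [set` s]) ball b.1 b.2.
Proof.
rewrite compact_cover => cK KP.
have [b _|D DP KD] := cK _ P (fun b => ball b.1 b.2) _ KP.
  exact: metric_ball_open.
exists (finmap.enum_fset D); split; first by move=> b /DP; rewrite inE.
exact: KD.
Qed.

Lemma measurable_ball_cover (s : seq (X * R)) :
  (@measurable _ (borelType X)) (\bigcup_(b in [set` s]) ball b.1 b.2).
Proof.
apply: measurable_open; apply: bigcup_open => b _; exact: metric_ball_open.
Qed.

(** Greedy Vitali selection, carried out as an induction on the number of balls: the balls meeting a
    largest ball [m] lie in its triple, whose measure costs a factor [C]; the others are disjoint
    from [m] and fall under the induction hypothesis. *)
Lemma vitali_measure_bound (g : borelType X -> \bar R) (l C : R)
    (s : seq (X * R)) :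
  measurable_fun setT g -> (forall x, 0 <= g x) -> (0 < l)%R -> (0 < C)%R ->
  (forall (x : X) r, (0 < r)%R ->
     mu (ball x (3 * r)%R) <= C%:E * mu (ball x r)) ->
  (forall b, b \in s -> (0 < b.2)%R /\
     l%:E * mu (ball b.1 b.2) <= \int[mu]_(y in ball b.1 b.2) g y) ->
  l%:E * mu (\bigcup_(b in [set` s]) ball b.1 b.2) <=
    C%:E * \int[mu]_(y in \bigcup_(b in [set` s]) ball b.1 b.2) g y.
Proof.
move=> mg g0 l0 C0 HC.
have [n] := ubnP (size s); elim: n s => // n IH s sn Hs.
have [->|s0] := eqVneq s [::].
  by rewrite set_nil bigcup_set0 measure0 mule0 integral_set0 mule0.
have [m ms mmax] : exists2 m, m \in s & forall b, b \in s -> (b.2 <= m.2)%R.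
  case: s s0 {sn Hs} => // b0 s _; elim: s b0 => [|c s IHs] b0.
    by exists b0; rewrite ?inE// => b; rewrite inE => /eqP ->.
  have [m ms mmax] := IHs c.
  have [bm|/ltW mb] := leP b0.2 m.2.
    exists m; first by rewrite inE ms orbT.
    by move=> b; rewrite inE => /orP[/eqP ->//|/mmax].
  exists b0; first by rewrite inE eqxx.
  move=> b; rewrite inE => /orP[/eqP ->//|/mmax bm]; exact: le_trans mb.
have [m0 Hm] := Hs _ ms.
pose far b := `[< ball b.1 b.2 `&` ball m.1 m.2 = set0 >].
pose s' := [seq b <- s | far b].
have s's b : b \in s' -> b \in s by rewrite mem_filter => /andP[].
(* The ball [m] contains its centre, hence meets itself and is dropped from [s']. *)
have ss' : (size s' < n)%N.
  rewrite -ltnS; apply: leq_trans sn; rewrite ltnS size_filter.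
  have : has (predC far) s.
    apply/hasP; exists m => //=; apply/negP => /asboolP.
    rewrite setIid => /seteqP[/(_ m.1) + _]; apply.
    by apply/ball_mdistP; rewrite mdistxx.
  by rewrite has_count => h; rewrite -(count_predC far s) -addn1 leq_add2l.
have {}IH := IH _ ss' (fun b bs => Hs b (s's _ bs)).
set U := \bigcup_(b in _) _; set U' := (X in _ * mu X <= _ * integral _ X _) in IH.
have mU : (@measurable _ (borelType X)) U by exact: measurable_ball_cover.
have mU' : (@measurable _ (borelType X)) U' by exact: measurable_ball_cover.
have mB := @measurable_metric_ball R X.
(* A ball that meets [m] has radius at most [m.2], so its points are within [m.2 + 2 * m.2] of the
   centre of [m]. *)
have UB : U `<=` ball m.1 (3 * m.2)%R `|` U'.
  move=> y [b /= bs by_]; have [fb|nfb] := boolP (far b).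
    by right; exists b => //=; rewrite mem_filter fb.
  left; move/asboolPn: nfb => /eqP/set0P[z [/ball_mdistP bz /ball_mdistP mz]].
  apply/ball_mdistP; move/ball_mdistP : by_; have := mmax _ bs.
  have := metric_triangle m.1 z y; have := metric_triangle z b.1 y.
  by rewrite (metric_sym z b.1); lra.
have dB : [disjoint ball m.1 m.2 & U'].
  apply/disj_setPS => y [my [b /= + by_]]; rewrite mem_filter => /andP[/asboolP + _].
  by move=> /seteqP[/(_ y) + _]; apply.
have BU : ball m.1 m.2 `|` U' `<=` U.
  move=> y [my|[b /= /s's bs by_]]; [by exists m|by exists b].
apply: (@le_trans _ _ (l%:E * (mu (ball m.1 (3 * m.2)%R) + mu U'))).
  rewrite lee_pmul2l//; apply: (@le_trans _ _ (mu (ball m.1 (3 * m.2)%R `|` U'))).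
    by apply: le_measure; rewrite ?inE//; apply: measurableU.
  by apply: measureU2.
apply: (@le_trans _ _ (C%:E * (\int[mu]_(y in ball m.1 m.2) g y + \int[mu]_(y in U') g y))).
  rewrite [leLHS]ge0_muleDr// [leRHS]ge0_muleDr ?integral_ge0//; apply: leeD => //.
  apply: (@le_trans _ _ (C%:E * (l%:E * mu (ball m.1 m.2)))); last by rewrite lee_pmul2l.
  by rewrite muleCA lee_pmul2l// HC.
rewrite lee_pmul2l// -ge0_integral_setU//; last exact: measurable_funTS.
apply: ge0_subset_integral => //; first exact: measurableU.
exact: measurable_funTS.
Qed.

(** The superlevel sets are open: if the integral over [ball x (r - e)] already exceeds [a], so does
    the one over [ball y r] for every [y] within [e] of [x]. *)
Lemma measurable_integral_ball (g : borelType X -> \bar R) (r : R) :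
  measurable_fun setT g -> (forall x, 0 <= g x) ->
  measurable_fun setT (fun x : borelType X => \int[mu]_(y in ball (x : X) r) g y).
Proof.
move=> mg g0; apply: (measurability _ (ErealGenOInfty.measurableE R)) => //.
move=> _ [_ [a ->] <-]; rewrite setTI; apply: measurable_open.
apply: open_ballP => x /=; rewrite in_itv/= andbT => ax.
have [e e0 ae] := lt_integral_inner_ball mg g0 ax.
exists e => // y /ball_mdistP xy /=; rewrite in_itv/= andbT.
apply: lt_le_trans ae _; apply: ge0_subset_integral => //.
- exact: measurable_metric_ball.
- exact: measurable_metric_ball.
- exact: measurable_funTS.
- by apply: subset_ball_mdist; rewrite metric_sym; lra.
Qed.

Lemma measurable_average (r : R) (f : borelType X -> R) : (0 < r)%R ->
  measurable_fun setT f -> measurable_fun setT (average mu r f).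
Proof.
move=> r0 mf; rewrite /average.
apply: emeasurable_funM; last first.
  by apply: measurable_integral_ball => //; apply: measurableT_comp => //; apply/measurable_EFinP.
(* The measure of a ball is the ball integral of 1, so the preceding lemma applies to it too; being
   finite and positive, it is inverted as a real power. *)
have -> : (fun x : borelType X => (mu (ball (x : X) r))^-1) =
  EFin \o ((powR (R:=R))^~ (-1)%R \o (fine \o (fun x : borelType X => \int[mu]_(y in ball (x : X) r) (cst 1) y))).
  apply/funext => x /=; rewrite integral_cst ?mul1e; last exact: measurable_metric_ball.
  rewrite powR_inv1 ?fine_ge0// -{1}(fineK (mu_ball_fin_num x r)) inver.
  by rewrite gt_eqF// mu_ball_gt0.
apply/measurable_EFinP; apply: measurableT_comp; first exact: measurable_powR.
apply: measurableT_comp => //.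
exact: measurable_integral_ball.
Qed.

End doubling_space.

(** * The local maximal operator: sublinearity, measurability, weak type (1,1) *)

Section maximal.
Context (R : realType) (X : pmetricType R).
Variable mu : {measure set (borelType X) -> \bar R}.
Hypothesis hX : doubling_metric_measure_space mu.
Local Open Scope ereal_scope.
Implicit Types (f g h : borelType X -> R) (x : borelType X).

Lemma measurable_abse_EFin f : measurable_fun setT f ->
  measurable_fun setT (fun x => `|(f x)%:E|).
Proof. by move=> mf; apply: measurableT_comp => //; apply/measurable_EFinP. Qed.

Lemma lt_average c r f x : (0 < r)%R ->
  (c%:E < average mu r f x) =
  (c%:E * mu (ball (x : X) r) < \int[mu]_(y in ball (x : X) r) `|(f y)%:E|).
Proof.
move=> r0; rewrite /average -(fineK (mu_ball_fin_num hX x r)).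
have m0 := mu_ball_gt0 hX x r0.
by rewrite inver gt_eqF// lte_pdivlMl// muleC.
Qed.

Lemma average_ge0 r f x : 0 <= average mu r f x.
Proof. by apply: mule_ge0; [by rewrite inve_ge0|exact: integral_ge0]. Qed.

Lemma average_le_local_maximal rho r f x : (0 < r < rho)%R ->
  average mu r f x <= local_maximal mu rho f x.
Proof. by move=> rr; apply: ereal_sup_ubound; exists r. Qed.

Lemma local_maximal_ge0 rho f x : (0 < rho)%R -> 0 <= local_maximal mu rho f x.
Proof.
move=> rho0; apply: (le_trans (average_ge0 (rho / 2) f x)).
by apply: average_le_local_maximal; lra.
Qed.

(** Monotonicity, subadditivity and homogeneity in a single inequality, the form in which the
    interpolation uses them. *)
Lemma local_maximal_le_add rho t f g h x : (0 <= t)%R ->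
  measurable_fun setT g -> measurable_fun setT h -> measurable_fun setT f ->
  (forall y, `|f y| <= `|g y| + t * `|h y|)%R ->
  local_maximal mu rho f x <=
    local_maximal mu rho g x + t%:E * local_maximal mu rho h x.
Proof.
move=> t0 mg mh mf fgh; apply: ge_ereal_sup => _ [r /= rr <-].
have mB : measurable (ball (x : X) r : set (borelType X)) by exact: measurable_metric_ball.
apply: (@le_trans _ _ (average mu r g x + t%:E * average mu r h x)); last first.
  by apply: leeD; rewrite ?lee_wpmul2l//; exact: average_le_local_maximal.
have m0 : 0 <= (mu (ball (x : X) r))^-1 by rewrite inve_ge0.
rewrite /average muleCA -ge0_muleDr ?mule_ge0 ?integral_ge0//.
have mA (k : borelType X -> R) : measurable_fun setT k -> measurable_fun (ball (x : X) r : set (borelType X)) (fun y => `|(k y)%:E|).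
  by move=> mk; apply: measurable_funTS; exact: measurable_abse_EFin.
apply: lee_wpmul2l => //; rewrite -ge0_integralZl ?lee_fin//; last exact: mA.
rewrite -ge0_integralD//; last 3 first.
- exact: mA.
- by move=> y _; rewrite mule_ge0.
- by apply: measurable_funeM; exact: mA.
apply: ge0_le_integral => //.
- exact: mA.
- by apply: emeasurable_funD; [exact: mA|apply: measurable_funeM; exact: mA].
- by move=> y _ /=; rewrite -EFinM -EFinD lee_fin.
Qed.

(** All radii are below [rho], so the averages at [x] only see values of [f] in [ball x0 s]. This
    reduces locally integrable functions to integrable ones. *)
Lemma local_maximal_localize rho (x0 : X) s f x :
  (mdist x0 (x : X) + rho <= s)%R ->
  local_maximal mu rho f x = local_maximal mu rho (f \* \1_(ball x0 s))%R x.
Proof.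
move=> xs; rewrite /local_maximal; congr ereal_sup.
apply: eq_imagel => r /= rr; rewrite /average; congr (_ * _).
apply: eq_integral => y; rewrite inE => xy /=.
rewrite indicE mem_set ?mulr1//.
by apply: subset_ball_mdist xy; lra.
Qed.

(** An enumeration of the rationals of the interval from 0 to [rho]; the default [rho / 2] keeps
    every term an admissible radius. *)
Let radius (rho : R) (n : nat) : R :=
  if unpickle n is Some q then
    (if 0 < (ratr q : R) < rho then ratr q else rho / 2)%R
  else (rho / 2)%R.

Let radius_bounds rho n : (0 < rho)%R -> (0 < radius rho n < rho)%R.
Proof.
by move=> rho0; rewrite /radius; case: unpickle => [q|]; [case: ifPn => // _|]; lra.
Qed.

(* Ball integrals are left-continuous in the radius, so rational radii suffice. *)
Let local_maximal_countable rho f x : (0 < rho)%R -> measurable_fun setT f ->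
  local_maximal mu rho f x = esups (fun n => average mu (radius rho n) f x) 0%N.
Proof.
move=> rho0 mf; rewrite /local_maximal; apply/eqP; rewrite eq_le; apply/andP; split; last first.
  apply: ge_ereal_sup => _ [n _ <-]; apply: average_le_local_maximal.
  exact: radius_bounds.
apply: ge_ereal_sup => _ [r /= /andP[r0 rrho] <-]; set S := esups _ _.
have SE n : average mu (radius rho n) f x <= S by apply: ereal_sup_ubound; exists n.
have S0 : 0 <= S by apply: le_trans (SE 0%N); exact: average_ge0.
rewrite leNgt; apply/negP => Sr.
have Sf : S \is a fin_num by rewrite ge0_fin_numE//; apply: lt_le_trans Sr _; rewrite leey.
move: Sr; rewrite -(fineK Sf) lt_average// => Sr.
have [e e0 Se] := lt_integral_inner_ball (measurable_abse_EFin mf) (fun=> abse_ge0 _) Sr.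
(* The ball of radius [q] contains the one of radius [r - e] and has at most the measure of the one
   of radius [r], so its average still exceeds [S]. *)
have [q] := @rat_in_itvoo R (Num.max 0 (r - e))%R r ltac:(by rewrite gt_max r0 gtrBl).
rewrite in_itv/= gt_max => /andP[/andP[q0 req] qr].
have qrad : radius rho (pickle q) = ratr q.
  by rewrite /radius pickleK ifT// q0 (lt_trans qr).
have := SE (pickle q); rewrite qrad leNgt => /negP; apply.
rewrite -(fineK Sf) lt_average//.
apply: (@le_lt_trans _ _ ((fine S)%:E * mu (ball (x : X) r))).
  apply: lee_wpmul2l; first by rewrite lee_fin fine_ge0.
  by apply: le_measure; rewrite ?inE; [exact: measurable_metric_ball|exact: measurable_metric_ball|apply: le_ball; exact: ltW].
apply: (lt_le_trans Se); apply: ge0_subset_integral => //.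
- exact: measurable_metric_ball.
- exact: measurable_metric_ball.
- by apply: measurable_funTS; exact: measurable_abse_EFin.
- by apply: le_ball; exact: ltW.
Qed.

Lemma measurable_local_maximal rho f : (0 < rho)%R -> measurable_fun setT f ->
  measurable_fun setT (local_maximal mu rho f).
Proof.
move=> rho0 mf.
rewrite (_ : local_maximal mu rho f = fun x => esups (fun n => average mu (radius rho n) f x) 0%N).
  apply: measurable_fun_esups => n; apply: measurable_average => //.
  by have /andP[] := radius_bounds n rho0.
by apply/funext => x; exact: local_maximal_countable.
Qed.

(** The level set lies in the union [U] of all balls with average at least [l]. Inner regularity
    replaces [U] by a compact subset, compactness leaves finitely many balls, and the Vitali bound
    applies. Two doublings suffice for tripled balls, and the constant is the same for all [rho]. *)
Lemma weak_type_local_maximal : exists2 C : R, (0 < C)%R &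
  forall rho l f, (0 < rho)%R -> (0 < l)%R -> measurable_fun setT f ->
    l%:E * mu [set x | l%:E < local_maximal mu rho f x] <=
      C%:E * \int[mu]_x `|(f x)%:E|.
Proof.
have [C C0 HC] := doubling_pow hX 2; exists C => // rho l f rho0 l0 mf.
have HC3 (x : X) r : (0 < r)%R -> mu (ball x (3 * r)%R) <= C%:E * mu (ball x r).
  move=> r0; apply: le_trans (HC x r r0); apply: le_measure; rewrite ?inE.
  - exact: measurable_metric_ball.
  - exact: measurable_metric_ball.
  - by apply: le_ball; rewrite expr2; lra.
pose P : set (X * R) := [set b | (0 < b.2)%R /\
  l%:E * mu (ball b.1 b.2) <= \int[mu]_(y in ball b.1 b.2) `|(f y)%:E|].
pose U := \bigcup_(b in P) ball b.1 b.2.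
have oU : open U by apply: bigcup_open => b _; exact: metric_ball_open.
rewrite -lee_pdivlMl//; apply: (@le_trans _ _ (mu U)).
  apply: le_measure; rewrite ?inE.
  - by apply: measurable_set_lt => //; exact: measurable_local_maximal.
  - exact: measurable_open.
  - move=> x /= /ereal_sup_gt[_ [r /= /andP[r0 rrho] <-]].
    rewrite lt_average// => /ltW lx; exists (x : X, r) => //=.
    by apply/ball_mdistP; rewrite mdistxx.
have [_ _ ->//] := dmms_radon hX.
apply: ge_ereal_sup => _ [K /= [cK KU] <-].
have [s [sP Ks]] := compact_ball_cover cK KU.
rewrite lee_pdivlMl//.
have mS := measurable_ball_cover s.
apply: (@le_trans _ _ (l%:E * mu (\bigcup_(b in [set` s]) ball b.1 b.2))).
  rewrite lee_pmul2l//; apply: le_measure; rewrite ?inE//.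
  exact: measurable_compact.
have mf' := measurable_abse_EFin mf.
apply: (le_trans (vitali_measure_bound mf' (fun=> abse_ge0 _) l0 C0 HC3 sP)).
rewrite lee_pmul2l//; apply: ge0_subset_integral => //.
Qed.

End maximal.

(** * Finite covers of balls, Radon densities, finiteness of the maximal function *)

Section regularity.
Context (R : realType) (X : pmetricType R).
Variable mu : {measure set (borelType X) -> \bar R}.
Hypothesis hX : doubling_metric_measure_space mu.
Local Open Scope ereal_scope.

(** Balls need not be relatively compact here. Instead, a compact [K] carries so much of the mass of
    the enlarged ball [U] that every [ball y s] centred in [ball x0 r] must meet it; a finite cover
    of [K] by balls of radius [s] then becomes a cover of [ball x0 r] once the radii are doubled. *)
Lemma ball_finite_cover (x0 : X) (r s : R) : (0 < r)%R -> (0 < s)%R ->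
  exists t : seq X, ball x0 r `<=` \bigcup_(y in [set` t]) ball y (2 * s)%R.
Proof.
move=> r0 s0; have [n ns] : exists n, (2 * r + s <= 2 ^+ n * s)%R.
  exists (Num.trunc ((2 * r + s) / s)).+1; rewrite -ler_pdivrMr//.
  apply: (le_trans (ltW (truncnS_gt _))).
  by rewrite -natrX ler_nat ltnW// ltn_expl.
have [C C0 HC] := doubling_pow hX n.
pose U : set X := ball x0 (r + s)%R.
have mU := @measurable_metric_ball R X x0 (r + s)%R.
pose m := fine (mu U); have m0 : (0 < m)%R by apply: mu_ball_gt0 => //; lra.
have mUE : mu U = m%:E by rewrite fineK// mu_ball_fin_num.
have [_ _ /(_ _ (metric_ball_open x0 (r + s)%R)) mUK] := dmms_radon hX.
(* The deficit [m / C] is the lower bound on [mu (ball y s)] given by [n] doublings: [U] lies in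
   [ball y (2 * r + s)], hence in [ball y (2 ^+ n * s)]. *)
have : (m - m / C)%:E < mu U by rewrite mUE lte_fin gtrBl divr_gt0.
rewrite mUK => /ereal_sup_gt[_ [K /= [cK KU] <-] mK].
have [|L [Ls KL]] := @compact_ball_cover _ _ K [set b | b.2 = s] cK.
  by move=> x _; exists (x, s) => //; apply/ball_mdistP; rewrite mdistxx.
exists (map fst L) => y /ball_mdistP x0y.
have [[z [/ball_mdistP yz Kz]]|Ky] := pselect (exists z, ball y s z /\ K z).
  have [b /= bL /ball_mdistP bz] := KL _ Kz.
  exists b.1 => /=; first exact: map_f.
  apply/ball_mdistP; have := metric_triangle b.1 z y; rewrite (metric_sym z y).
  by rewrite (Ls _ bL) in bz; lra.
(* Otherwise [K] and [ball y s] would be disjoint subsets of [U] of total mass above [m]. *)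
exfalso; move: mK; apply/negP; rewrite -leNgt EFinB leeBrDr// -mUE.
have mB := @measurable_metric_ball R X y s.
have mKm := measurable_compact cK.
apply: (@le_trans _ _ (mu K + mu (ball y s))).
  rewrite leeD2l// mulrC EFinM lee_pdivrMl// -mUE.
  apply: (le_trans _ (HC y s s0)); apply: le_measure; rewrite ?inE//.
    exact: measurable_metric_ball.
  by apply: subset_ball_mdist; rewrite metric_sym; lra.
rewrite -measureU//; last first.
  by apply/seteqP; split => // z [Kz yz]; apply: Ky; exists z.
apply: le_measure; rewrite ?inE//; first exact: measurableU.
move=> z [/KU//|]; apply: subset_ball_mdist; lra.
Qed.

Section bounded_density.
Variable u : borelType X -> R.
Hypothesis measurable_u : measurable_fun setT u.
Hypothesis u01 : forall x, (0 < u x <= 1)%R.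

Let nu (A : set X) := \int[mu]_(x in (A : set (borelType X))) (u x)%:E.

Let u_ge0 x : 0 <= (u x)%:E.
Proof. by have /andP[/ltW] := u01 x. Qed.

Let mEu (A : set (borelType X)) : measurable_fun A (EFin \o u).
Proof. by apply: measurable_funTS; apply/measurable_EFinP. Qed.

Let nu_le_mu (A : set (borelType X)) : measurable A -> nu A <= mu A.
Proof.
move=> mA; rewrite -[leRHS]mul1e -integral_cst//; apply: ge0_le_integral => //.
by move=> x _; have /andP[] := u01 x.
Qed.

Let nu_le (A B : set (borelType X)) : measurable A -> measurable B -> A `<=` B -> nu A <= nu B.
Proof. by move=> mA mB AB; apply: ge0_subset_integral => //; exact: mEu. Qed.

Let nu_diff (A B : set (borelType X)) : measurable A -> measurable B -> A `<=` B ->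
  nu B <= nu A + mu (B `\` A).
Proof.
move=> mA mB AB; have mD := measurableD mB mA.
apply: (@le_trans _ _ (nu A + nu (B `\` A))); last by rewrite leeD2l// nu_le_mu.
rewrite /nu -ge0_integral_setU//; first by rewrite setDUK.
by apply/disj_setPS => x [Ax [_ /(_ Ax)]].
Qed.

(* Regularity passes from mu to [u dmu] because [u dmu <= mu]; only sets of
   finite measure matter, after cutting with the balls of integer radius. *)
Lemma weight_of_bounded : weight mu u.
Proof.
split=> //; first by move=> x; have /andP[] := u01 x.
have [mu_compact mu_outer mu_inner] := dmms_radon hX.
have mB := @measurable_metric_ball R X point.
split.
- move=> A cA; apply: le_lt_trans (mu_compact A cA).
  by apply: nu_le_mu; exact: measurable_compact.
- move=> A mA; apply/eqP; rewrite eq_le; apply/andP; split.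
    apply: le_ereal_inf_tmp => _ [U /= [oU AU] <-].
    by apply: nu_le => //; exact: measurable_open.
  apply/lee_addgt0Pr => e e0.
  pose An n := A `&` ball (point : X) n%:R.
  have mAn n : (@measurable _ (borelType X)) (An n) by apply: measurableI.
  have AnF n : mu (An n) \is a fin_num.
    rewrite ge0_fin_numE//; apply: (@le_lt_trans _ _ (mu (ball (point : X) n%:R))).
      by apply: le_measure; rewrite ?inE//; exact: subIsetr.
    by rewrite -ge0_fin_numE// mu_ball_fin_num.
  have /choice[U HU] n : exists U : set X, [/\ open U, An n `<=` U &
      mu (U `\` An n) <= (e / (2 ^ n.+1)%:R)%:E].
    have : mu (An n) < mu (An n) + (e / (2 ^ n.+1)%:R)%:E.
      by rewrite lteDl// lte_fin divr_gt0// ltr0n expn_gt0.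
    rewrite {1}mu_outer// => /ereal_inf_lt[_ [U /= [oU AU] <-] hU].
    exists U; split => //; rewrite measureD//.
    - by rewrite setIidr// leeBlDl ?AnF// ltW.
    - exact: measurable_open.
    - by apply: (lt_trans hU); rewrite -ge0_fin_numE ?adde_ge0// ?fin_numD ?AnF// lee_fin divr_ge0// ltW.
  pose V := \bigcup_n U n.
  have oV : open V by apply: bigcup_open => n _; have [] := HU n.
  have mV := measurable_open oV.
  have AV : A `<=` V.
    move=> x Ax; have : [set: X] x by []. 
    rewrite -(bigcup_ball_nat point) => -[n _ nx].
    by exists n => //; have [_ + _] := HU n; apply.
  (* The excess [V] minus [A] is covered by the sets [U n] minus [An n], whose [mu]-measures add up
     to at most [e]. *)
  apply: (@le_trans _ _ (nu V)); first by apply: ereal_inf_lbound; exists V.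
  apply: (le_trans (nu_diff mA mV AV)); rewrite leeD2l//.
  apply: (@le_trans _ _ (\sum_(n <oo) mu (U n `\` An n))).
    apply: measure_sigma_subadditive => //.
    - by move=> n; apply: measurableD => //; have [/measurable_open] := HU n.
    - exact: measurableD.
    - move=> x [[n _ Ux] Ax]; exists n => //; split => // -[/Ax[]].
  apply: (le_trans _ (epsilon_trick0 xpredT (ltW e0))).
  by apply: lee_nneseries => // n _; have [] := HU n.
- move=> U oU; have mU := measurable_open oU.
  apply/eqP; rewrite eq_le; apply/andP; split; last first.
    apply: ge_ereal_sup => _ [K /= [cK KU] <-].
    by apply: nu_le => //; exact: measurable_compact.
  set S := ereal_sup _.
  pose Un n := U `&` ball (point : X) n%:R.
  have oUn n : open (Un n) by apply: openI => //; exact: metric_ball_open.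
  have mUn n := measurable_open (oUn n).
  have UnE : \bigcup_n Un n = U by rewrite -setI_bigcupr bigcup_ball_nat setIT.
  rewrite -[leLHS]/(nu U) -UnE.
  have nd : nondecreasing_seq (Un : nat -> set (borelType X)).
    by move=> i j ij; rewrite subsetEset; apply: setIS; apply: le_ball; rewrite ler_nat.
  have cv : nu (Un n) @[n --> \oo] --> nu (\bigcup_n Un n) :=
    @ge0_nondecreasing_set_cvg_integral _ _ _ _ (EFin \o u) mu nd mUn
    (fun n => @mEu (Un n)) (fun n x _ => u_ge0 x).
  rewrite -(cvg_lim _ cv)//; apply: lime_le; first by apply/cvg_ex; eexists; exact: cv.
  apply: nearW => n; apply/lee_addgt0Pr => e e0.
  have UnF : mu (Un n) \is a fin_num.
    rewrite ge0_fin_numE//; apply: (@le_lt_trans _ _ (mu (ball (point : X) n%:R))).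
      by apply: le_measure; rewrite ?inE//; exact: subIsetr.
    by rewrite -ge0_fin_numE// mu_ball_fin_num.
  have : mu (Un n) - e%:E < mu (Un n) by rewrite lteBlDr// lteDl.
  rewrite {2}mu_inner// => /ereal_sup_gt[_ [K /= [cK KU] <-] mK].
  have mKm := measurable_compact cK.
  apply: (le_trans (nu_diff mKm (mUn n) KU)); apply: leeD.
    by apply: ereal_sup_ubound; exists K => //; split => // x /KU[].
  rewrite measureD// -?ge0_fin_numE// setIidr//.
  have KF : mu K \is a fin_num by rewrite ge0_fin_numE// mu_compact.
  by rewrite leeBlDr// addeC -leeBlDr// ltW.
Qed.

End bounded_density.

(** On each ball of integer radius, [f] may be cut off to an integrable function with the same
    maximal function there; the weak type bound at every level [l] then makes the infinite set
    null. *)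
Lemma local_maximal_lty_ae (x0 : X) rho (f : borelType X -> R) :
  (0 < rho)%R -> measurable_fun setT f ->
  (forall r, (0 < r)%R -> \int[mu]_(y in ball x0 r) `|(f y)%:E| < +oo) ->
  mu [set x | local_maximal mu rho f x = +oo] = 0.
Proof.
move=> rho0 mf fi; have [C C0 HC] := weak_type_local_maximal hX.
set N := [set x | _].
have mN : measurable N.
  rewrite -[N]setTI; exact: (measurable_local_maximal hX rho0 mf measurableT (emeasurable_set1 +oo)).
have mNn n : measurable (N `&` ball x0 n%:R : set (borelType X)).
  by apply: measurableI; [|exact: measurable_metric_ball].
suff Nn0 n : mu (N `&` ball x0 n%:R : set (borelType X)) = 0.
  rewrite -[N]setIT -(bigcup_ball_nat x0) setI_bigcupr.
  apply/eqP; rewrite eq_le measure_ge0 andbT.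
  apply: (le_trans (measure_sigma_subadditive _ mNn _ (@subset_refl _ _))).
    exact: bigcupT_measurable.
  by rewrite eseries0// => n _ _; exact: Nn0.
pose s := (n%:R + rho)%R; have s0 : (0 < s)%R by rewrite ltr_wpDl.
pose fn := (f \* \1_(ball x0 s))%R : borelType X -> R.
have mfn : measurable_fun setT fn.
  by apply: measurable_funM => //; apply: measurable_indic; exact: measurable_metric_ball.
have fnE : \int[mu]_x `|(fn x)%:E| = \int[mu]_(x in ball x0 s) `|(f x)%:E|.
  rewrite [RHS]integral_mkcond; apply: eq_integral => x _.
  rewrite patchE /fn /= indicE; case: ifPn => _; first by rewrite mulr1.
  by rewrite mulr0 normr0.
have := fi _ s0; rewrite -fnE; set J := integral _ _ _ => Jy.
have JF : J \is a fin_num by rewrite ge0_fin_numE// integral_ge0.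
have key l : (0 < l)%R -> l%:E * mu (N `&` ball x0 n%:R) <= C%:E * J.
  move=> l0; apply: le_trans (HC rho l fn rho0 l0 mfn); rewrite lee_pmul2l//.
  apply: le_measure; rewrite ?inE; first exact: mNn.
    by apply: measurable_set_lt => //; exact: measurable_local_maximal.
  move=> x [Nx /ball_mdistP nx] /=; rewrite -local_maximal_localize ?Nx ?ltry//.
  by rewrite lerD2r ltW.
set m := mu _ in key *.
have mF : m \is a fin_num.
  rewrite ge0_fin_numE ?measure_ge0//; apply: (@le_lt_trans _ _ (mu (ball x0 n%:R))).
    by apply: le_measure; rewrite ?inE//; exact: measurable_metric_ball.
  by rewrite -ge0_fin_numE// mu_ball_fin_num.
apply/eqP; rewrite eq_le measure_ge0 andbT leNgt; apply/negP => m0.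
have fm0 : (0 < fine m)%R by rewrite fine_gt0// m0 -ge0_fin_numE// ltW.
have J0 : (0 <= fine J)%R by rewrite fine_ge0// integral_ge0.
(* At this level the bound [key] would read [C * J + m <= C * J]. *)
have l0 : (0 < C * fine J / fine m + 1)%R.
  by rewrite ltr_wpDl// divr_ge0 ?mulr_ge0// ltW.
have := key _ l0; rewrite -(fineK mF) -(fineK JF) -!EFinM lee_fin mulrDl mul1r.
by rewrite divfK ?gt_eqF// gerDl leNgt fm0.
Qed.

End regularity.

(** * Dyadic level sums, a discrete substitute for the layer cake formula *)

Section dyadic_series.
Context (R : realType).
Local Open Scope ereal_scope.

(** A geometric sum of ratio [b = 2 ^ q] is at most [K = b / (b - 1)] times its last term, by
    induction through [K + b = K * b]; the last term present is below [y ^ q]. *)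
Lemma dyadic_partial_sum (q t y : R) (n : nat) : (0 < q)%R -> (0 < t)%R -> (0 <= y)%R ->
  (\sum_(0 <= j < n) (if t * 2 ^+ j < y then (t * 2 ^+ j) `^ q else 0) <=
    2 `^ q / (2 `^ q - 1) * y `^ q)%R.
Proof.
move=> q0 t0 y0; set b := (2 `^ q)%R; set K := (b / (b - 1))%R.
have b1 : (1 < b)%R.
  have -> : 1%R = (1 `^ q)%R by rewrite powR1.
  by apply: gt0_ltr_powR; rewrite ?nnegrE; lra.
have K0 : (0 <= K)%R by rewrite divr_ge0//; lra.
pose a j := (t * 2 ^+ j)%R; have a0 j : (0 <= a j)%R by rewrite mulr_ge0 ?exprn_ge0// ltW.
have ab j : (a j.+1 `^ q = b * a j `^ q)%R.
  by rewrite {1}/a exprS mulrCA powRM // -/(a j).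
have geo m : (\sum_(0 <= j < m.+1) a j `^ q <= K * a m `^ q)%R.
  elim: m => [|m IH].
    rewrite big_nat1 ler_peMl ?powR_ge0// /K ler_pdivlMr; lra.
  rewrite big_nat_recr//= ab; apply: (@le_trans _ _ (K * a m `^ q + b * a m `^ q)%R).
    by rewrite lerD2r.
  rewrite -mulrDl mulrA ler_wpM2r ?powR_ge0// le_eqVlt; apply/orP; left.
  by apply/eqP; rewrite /K; field; lra.
elim: n => [|n IH]; first by rewrite big_nil mulr_ge0// powR_ge0.
rewrite big_nat_recr//=; case: ifPn => [any|_]; last by rewrite addr0.
apply: (@le_trans _ _ (\sum_(0 <= j < n.+1) a j `^ q)%R).
  rewrite big_nat_recr//= lerD2r; apply: ler_sum => j _; case: ifPn => // _.
  exact: powR_ge0.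
apply: (le_trans (geo n)); apply: ler_wpM2l => //.
by apply: ge0_ler_powR; rewrite ?nnegrE ?a0//; exact: ltW.
Qed.

Lemma dyadic_series_le (q t y : R) : (0 < q)%R -> (0 < t)%R -> (0 <= y)%R ->
  \sum_(j <oo) (if t * 2 ^+ j < y then (t * 2 ^+ j) `^ q else 0)%R%:E <=
    (2 `^ q / (2 `^ q - 1) * y `^ q)%:E.
Proof.
move=> q0 t0 y0; apply: lime_le.
  by apply: is_cvg_nneseries => n _ _; case: ifPn => // _; rewrite lee_fin powR_ge0.
by apply: nearW => n; rewrite sumEFin lee_fin dyadic_partial_sum.
Qed.

(** If [m] is finite, a single term suffices: at the last level [t * 2 ^+ i * h] below [m], doubling
    the level reaches [m]. If all levels are below [m], the series diverges. *)
Lemma le_dyadic_series (p t : R) (h : R) (m : \bar R) : (1 <= p)%R -> (0 < t)%R ->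
  (0 < h)%R -> (t * h)%:E < m ->
  m `^ p * (h `^ (- p))%:E <=
    \sum_(j <oo) (if ((t * 2 ^+ j * h)%:E < m)%E then (2 * (t * 2 ^+ j)) `^ p else 0)%R%:E.
Proof.
move=> p1 t0 h0 thm; pose u (j : nat) : \bar R := (if ((t * 2 ^+ j * h)%:E < m)%E then (2 * (t * 2 ^+ j)) `^ p else 0)%R%:E.
rewrite -[leRHS]/(\sum_(j <oo) u j).
have u0 j : 0 <= u j by rewrite lee_fin; case: ifPn => // _; exact: powR_ge0.
have a0 j : (0 < t * 2 ^+ j)%R by rewrite mulr_gt0// exprn_gt0.
have [[j jm]|allj] := pselect (exists j, ~~ ((t * 2 ^+ j * h)%:E < m)).
  have := ex_intro _ j jm : exists j, _.
  move=> {j jm} /ex_minnP[[|i]]; first by rewrite expr0 mulr1 thm.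
  rewrite -leNgt => mi /(_ i); rewrite ltnn => /contraT im.
  apply: le_trans (nneseries_term_le i u0); rewrite /u im.
  have m0 : 0 <= m by rewrite (le_trans _ (ltW thm))// lee_fin mulr_ge0// ltW.
  have mf : m \is a fin_num by rewrite ge0_fin_numE// (le_lt_trans mi)// ltry.
  move: mi m0; rewrite -(fineK mf) poweR_EFin -EFinM !lee_fin => mi m0.
  have ai : (0 <= 2 * (t * 2 ^+ i))%R by rewrite mulr_ge0// ltW.
  rewrite powRN ler_pdivrMr ?powR_gt0// -(powRM _ ai (ltW h0)).
  apply: ge0_ler_powR; rewrite ?nnegrE//; first lra.
  - by rewrite mulr_ge0// ltW.
  - by apply: (le_trans mi); rewrite exprS mulrCA.
have {}allj j : (t * 2 ^+ j * h)%:E < m.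
  by apply/negPn/negP => H; apply: allj; exists j.
rewrite [leRHS](_ : _ = +oo) ?leey//; apply/eqP; rewrite -leye_eq leNgt.
apply/negP => Sy; set S := \sum_(_ <oo) _ in Sy.
have S0 : 0 <= S by apply: nneseries_ge0.
have Sf : S \is a fin_num by rewrite ge0_fin_numE.
(* The summand 1 puts the base of the power above 1, where [p >= 1] makes the power at least its
   base. *)
have [j tj] : exists j, (fine S + 1 < t * 2 ^+ j)%R.
  exists (Num.trunc (fine S / t + 1 / t)).+1.
  rewrite mulrC -ltr_pdivrMr// mulrDl; apply: (lt_le_trans (truncnS_gt _)).
  by rewrite -natrX ler_nat ltnW// ltn_expl.
have := nneseries_term_le j u0; rewrite -/S leNgt => /negP; apply.
rewrite -(fineK Sf) /u allj lte_fin.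
have fS : (0 <= fine S)%R by rewrite fine_ge0.
move: tj; generalize (t * 2 ^+ j)%R => z tj.
apply: (@lt_le_trans _ _ (2 * z)%R); first lra.
by apply: le1r_powR; lra.
Qed.

End dyadic_series.

(** * Marcinkiewicz interpolation for the operator [g |-> M (g s) / H] *)

Section interpolation.
Context d (T : measurableType d) (R : realType).
Variable mu : {measure set T -> \bar R}.
Local Open Scope ereal_scope.
Variable M : (T -> R) -> T -> \bar R.
Hypothesis M0 : forall f x, 0 <= M f x.
Hypothesis mM : forall f : T -> R, measurable_fun setT f -> measurable_fun setT (M f).
Hypothesis M_sublinear : forall (t : R) (f g h : T -> R) x, (0 <= t)%R ->
  measurable_fun setT g -> measurable_fun setT h -> measurable_fun setT f ->
  (forall y, `|f y| <= `|g y| + t * `|h y|)%R -> M f x <= M g x + t%:E * M h x.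
Variables (C : R) (C0 : (0 < C)%R).
Hypothesis M_weak_type : forall (l : R) (f : T -> R), (0 < l)%R -> measurable_fun setT f ->
  l%:E * mu [set x | l%:E < M f x] <= C%:E * \int[mu]_x `|(f x)%:E|.
Variables (p : R) (s H : T -> R).
Hypothesis p1 : (1 < p)%R.
Hypotheses (ms : measurable_fun setT s) (mH : measurable_fun setT H).
Hypotheses (s0 : forall x, (0 < s x)%R) (H1 : forall x, (1 <= H x)%R).
Hypothesis sH : mu [set x | (H x)%:E < M s x] = 0.

(** The Marcinkiewicz truncation: with [f = g s], it keeps the values where [|g| > a]. *)
Let part (a : R) (f : T -> R) x : R :=
  if (a * s x < `|f x|)%R then f x else 0%R.

Let mpart a f : measurable_fun setT f -> measurable_fun setT (part a f).
Proof.
move=> mf; apply: measurable_fun_ifT => //.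
apply: measurable_fun_ltr; first exact: measurable_funM.
exact: measurableT_comp.
Qed.

Let mlevel (a : R) f : measurable_fun setT f ->
  measurable [set x | (a * H x)%:E < M f x].
Proof.
move=> mf; apply: measurable_set_lt; last exact: mM.
by apply/measurable_EFinP; exact: measurable_funM.
Qed.

(* The part of [f] below [a/2 s] has maximal function at most [a/2 H]. *)
Let level_bound (a : R) (f : T -> R) : (0 < a)%R -> measurable_fun setT f ->
  a%:E * mu [set x | (a * H x)%:E < M f x] <=
    (2 * C)%:E * \int[mu]_x `|(part (a / 2) f x)%:E|.
Proof.
move=> a0 mf; have a2 : (0 < a / 2)%R by rewrite divr_gt0.
have mf1 := mpart (a / 2) mf.
pose N := [set x | (H x)%:E < M s x]; pose F := [set x | (a / 2)%:E < M (part (a / 2) f) x].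
have mN : measurable N.
  by apply: measurable_set_lt; [exact/measurable_EFinP|exact: mM].
have mF : measurable F by apply: measurable_set_lt => //; exact: mM.
have le1 : mu [set x | (a * H x)%:E < M f x] <= mu F.
  apply: (@le_trans _ _ (mu (F `|` N))); last by rewrite measureU0.
  apply: le_measure; rewrite ?inE; [exact: mlevel|exact: measurableU|].
  move=> x /= ax; have [|NHx] := pselect (N x); [by right|left; rewrite /F/=].
  have sx : M s x <= (H x)%:E by rewrite leNgt; apply/negP.
  have h := @M_sublinear (a / 2)%R f (part (a / 2) f) s x (ltW a2) mf1 ms mf.
  have {}h : (a * H x)%:E < M (part (a / 2) f) x + (a / 2 * H x)%:E.
    apply: (lt_le_trans ax); apply: le_trans (h _) _.
      move=> y; rewrite /part; case: ltP => [_|]; first by rewrite lerDl mulr_ge0// ltW.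
      by move=> fy; rewrite normr0 add0r (le_trans fy)// ler_wpM2l ?ler_norm// ltW.
    by rewrite leeD2l// (EFinM (a / 2) (H x)) lee_wpmul2l// lee_fin ltW.
  (* What remains is the level [a / 2 * H x], and [H >= 1] bounds it below by the constant level
     [a / 2] of [F]. *)
  move: h; rewrite -lteBlDr// -EFinB; apply: le_lt_trans; rewrite lee_fin.
  by have := H1 x; nra.
apply: (@le_trans _ _ (2%:E * ((a / 2)%:E * mu F))).
  by rewrite muleA -EFinM mulrCA divff// mulr1 lee_pmul2l.
by rewrite (EFinM 2 C) -[leRHS]muleA lee_pmul2l//; exact: M_weak_type.
Qed.

(** The integrand is dominated by a sum over the dyadic levels [t * 2 ^+ j], [level_bound] is
    applied at each level, and the truncations are summed pointwise. This is done where
    [M f > t * H], with a bound independent of [t]; then [t] tends to 0. *)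
Lemma sublinear_interpolation : exists C : R, forall f : T -> R,
  measurable_fun setT f ->
  \int[mu]_x (M f x `^ p * (H x `^ (- p))%:E) <=
  C%:E * \int[mu]_x (`|f x| `^ p * s x `^ (- (p - 1)))%:E.
Proof.
have p0 : (0 < p)%R by exact: lt_trans p1.
pose q := (p - 1)%R; have q0 : (0 < q)%R by rewrite subr_gt0.
pose K := (2 `^ q / (2 `^ q - 1))%R.
have K0 : (0 <= K)%R.
  rewrite divr_ge0 ?powR_ge0// subr_ge0.
  by rewrite -[leLHS](powRr0 2) ler_powR ?ler1n// ltW.
(* The factors come from the dyadic domination, from [level_bound], from the geometric sum, and from
   the factor 2 in the threshold [y] below. *)
exists (2 `^ p * (2 * C) * K * 2 `^ q)%R => f mf.
pose F x := M f x `^ p * (H x `^ (- p))%:E.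
have H0 x : (0 < H x)%R by apply: lt_le_trans (H1 x).
have F0 x : 0 <= F x by rewrite mule_ge0 ?poweR_ge0// lee_fin powR_ge0.
have mF : measurable_fun setT F.
  apply: emeasurable_funM; first exact: (measurableT_comp (measurable_poweR p)) (mM mf).
  by apply/measurable_EFinP; exact: (measurableT_comp (measurable_powR (- p))).
have mP : measurable_fun setT (fun x => `|f x| `^ p * s x `^ (- q))%R.
  apply: measurable_funM.
    by apply: (measurableT_comp (measurable_powR p)); exact: measurableT_comp.
  exact: (measurableT_comp (measurable_powR (- q))).
set rhs := leRHS.
pose D (t : R) := [set x | (t * H x)%:E < M f x].
have mD t : measurable (D t) by exact: mlevel.
have main t : (0 < t)%R -> \int[mu]_(x in D t) F x <= rhs.
  move=> t0; pose a j := (t * 2 ^+ j)%R.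
  have a0 j : (0 < a j)%R by rewrite mulr_gt0// exprn_gt0.
  pose G j x := ((2 * a j) `^ p * \1_(D (a j)) x)%:E.
  have mG j : measurable_fun setT (G j).
    by apply/measurable_EFinP; apply: measurable_funM => //; exact: measurable_indic.
  have G0 j x : 0 <= G j x by rewrite lee_fin mulr_ge0 ?powR_ge0.
  apply: (@le_trans _ _ (\int[mu]_x \sum_(j <oo) G j x)).
    apply: (@le_trans _ _ (\int[mu]_(x in D t) \sum_(j <oo) G j x)); last first.
      apply: ge0_subset_integral => //.
      - by apply: ge0_emeasurable_sum.
      - by move=> x _; exact: nneseries_ge0.
    apply: ge0_le_integral => //.
    - exact: measurable_funTS.
    - by apply: measurable_funTS; apply: ge0_emeasurable_sum.
    - move=> x Dx; apply: (le_trans (@le_dyadic_series _ p t (H x) (M f x) _ t0 (H0 x) Dx)).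
        exact: ltW.
      apply: lee_nneseries => j _; first by move=> _; case: ifPn => // _; rewrite lee_fin powR_ge0.
      rewrite /G indicE; case: ifPn => // h; last by rewrite lee_fin mulr_ge0 ?powR_ge0.
      by rewrite mem_set// mulr1.
  rewrite integral_nneseries//.
  (* Of [a j ^ p], one factor [a j] is spent on [level_bound], and [a j ^ q] remains. *)
  pose L j x := ((2 `^ p * (2 * C) * a j `^ q) * `|part (a j / 2) f x|)%:E.
  have L0 j x : 0 <= L j x by rewrite lee_fin !mulr_ge0 ?powR_ge0// ltW.
  have mL j : measurable_fun setT (L j).
    apply/measurable_EFinP; apply: measurable_funM => //.
    by apply: measurableT_comp => //; exact: mpart.
  apply: (@le_trans _ _ (\sum_(j <oo) \int[mu]_x L j x)).
    apply: lee_nneseries => j _; first by move=> _; exact: integral_ge0.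
    rewrite /G /L; under eq_integral do rewrite EFinM.
    under [leRHS]eq_integral do rewrite EFinM.
    rewrite !ge0_integralZl//.
    - rewrite integral_indic// setIT powRM ?(ltW (a0 j))//.
      rewrite -(mulr_powRB1 (ltW (a0 j)) p0) -/q.
      rewrite (_ : (2 `^ p * (a j * a j `^ q))%:E = (2 `^ p * a j `^ q)%:E * (a j)%:E); last first.
        by rewrite -EFinM; congr EFin; ring.
      rewrite (_ : (2 `^ p * (2 * C) * a j `^ q)%:E = (2 `^ p * a j `^ q)%:E * (2 * C)%:E); last first.
        by rewrite -EFinM mulrAC.
      rewrite -!muleA lee_wpmul2l ?lee_fin ?mulr_ge0 ?powR_ge0//.
      exact: level_bound.
    - by apply/measurable_EFinP; apply: measurableT_comp => //; exact: mpart.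
    - by rewrite lee_fin !mulr_ge0 ?powR_ge0// ltW.
    - by apply/measurable_EFinP; exact: measurable_indic.
    - by rewrite lee_fin powR_ge0.
  rewrite -integral_nneseries// /rhs -ge0_integralZl//.
  - apply: ge0_le_integral => //.
    + by move=> x _; exact: nneseries_ge0.
    + exact: ge0_emeasurable_sum.
    + by apply/measurable_EFinP; apply: measurable_funM => //; exact/measurable_EFinP.
    (* The truncation at [a j / 2] keeps [f x] exactly when [a j < y]. *)
    + move=> x _; pose y := (2 * `|f x| / s x)%R.
      have y0 : (0 <= y)%R by rewrite divr_ge0 ?mulr_ge0// ltW.
      pose c := (2 `^ p * (2 * C) * `|f x|)%R.
      have c0 : (0 <= c)%R by rewrite !mulr_ge0 ?powR_ge0// ltW.
      have LE j : L j x = c%:E * (if t * 2 ^+ j < y then (t * 2 ^+ j) `^ q else 0)%R%:E.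
        rewrite /L /part -EFinM /c; congr EFin.
        have -> : (a j / 2 * s x < `|f x|)%R = (t * 2 ^+ j < y)%R.
          by rewrite /y ltr_pdivlMr// -/(a j) mulrAC ltr_pdivrMr// (mulrC 2%R).
        case: ifPn => _; last by rewrite normr0 !mulr0.
        by rewrite -/(a j) -!mulrA; do 3 congr (_ * _)%R; rewrite mulrC.
      rewrite (eq_eseriesr (fun j _ => LE j)) nneseriesZl; last first.
        by move=> j _; case: ifPn => // _; rewrite lee_fin powR_ge0.
      apply: (le_trans (lee_wpmul2l _ (dyadic_series_le q0 t0 y0))); first by rewrite lee_fin.
      rewrite -/K -!EFinM lee_fin le_eqVlt; apply/orP; left; apply/eqP.
      rewrite /y powRM ?mulr_ge0 ?invr_ge0 ?(ltW (s0 x))// powRM//.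
      rewrite -[(_ ^-1)%R in LHS]powR_inv1 ?(ltW (s0 x))// -powRrM mulN1r.
      rewrite -(mulr_powRB1 (normr_ge0 (f x)) p0) -/q /c; ring.
  - exact/measurable_EFinP.
  - by move=> x _; rewrite lee_fin mulr_ge0 ?powR_ge0.
  - by rewrite lee_fin mulr_ge0 ?powR_ge0// mulr_ge0// mulr_ge0 ?powR_ge0// mulr_ge0// ltW.
(* The sets [D (1/(n+1))] exhaust the set where [M f > 0]; elsewhere [F] vanishes. *)
have DE : \bigcup_n D (n.+1%:R^-1)%R = [set x | 0 < M f x].
  apply/seteqP; split => x /=.
    by move=> [n _] /=; apply: le_lt_trans; rewrite lee_fin mulr_ge0// ltW.
  move=> /lt_EFin_dense[r r0 rM].
  have := divr_gt0 r0 (H0 x) => /ltr_add_invr[n]; rewrite add0r => nr.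
  exists n => //; rewrite /D/=; apply: le_lt_trans rM.
  by rewrite lee_fin -ler_pdivlMr// ltW.
have -> : \int[mu]_x F x = \int[mu]_(x in \bigcup_n D (n.+1%:R^-1)%R) F x.
  rewrite [RHS]integral_mkcond; apply: eq_integral => x _; rewrite patchE.
  case: ifPn => // /negP xD; rewrite /F.
  have /eqP -> : M f x == 0.
    rewrite eq_le M0 andbT leNgt; apply/negP => Mx.
    by apply: xD; rewrite inE DE.
  by rewrite poweR0r ?mul0e// gt_eqF.
have nd : nondecreasing_seq (fun n => D (n.+1%:R^-1)%R : set T).
  move=> m n mn; rewrite subsetEset => x; rewrite /D/=; apply: le_lt_trans.
  by rewrite lee_fin ler_wpM2r ?(ltW (H0 x))// lef_pV2 ?posrE// ler_nat.
have cv : \int[mu]_(x in D (n.+1%:R^-1)%R) F x @[n --> \oo] -->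
    \int[mu]_(x in \bigcup_n D (n.+1%:R^-1)%R) F x.
  apply: (ge0_nondecreasing_set_cvg_integral nd) => // n; exact: measurable_funTS.
rewrite -(cvg_lim _ cv)//; apply: lime_le; first by apply/cvg_ex; eexists; exact: cv.
by apply: nearW => n; exact: main.
Qed.

End interpolation.

(** * The condition [DpM] made explicit, and the weight for [p > 1] *)

Section maximal_weights.
Context (R : realType) (X : pmetricType R).
Variable mu : {measure set (borelType X) -> \bar R}.
Hypothesis hX : doubling_metric_measure_space mu.
Local Open Scope ereal_scope.
Variables (x0 : X) (rho : R) (v : borelType X -> R).
Hypothesis rho0 : (0 < rho)%R.
Hypotheses (mv : measurable_fun setT v) (v0 : forall x, (0 < v x)%R).

Lemma hoelder_conjugate_gt1 (p : R) : (1 < p)%R ->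
  hoelder_conjugate p%:E = (p / (p - 1))%:E.
Proof.
move=> p1; have p0 : (0 < p)%R by exact: lt_trans p1.
rewrite /hoelder_conjugate /= eqe gt_eqF// -EFinB inver subr_eq0 gt_eqF//.
Qed.

(** The conjugate exponent is [p / (p - 1)], and raising [v ^ (-1/p)] to it gives
    [v ^ (-1/(p-1))]. *)
Lemma DpM_gt1P (p : R) : (1 < p)%R ->
  DpM mu x0 p v <-> forall r, (0 < r)%R ->
    \int[mu]_(y in ball x0 r) (v y `^ (- (p - 1)^-1))%:E < +oo.
Proof.
move=> p1; have p0 : (0 < p)%R by exact: lt_trans p1.
have q0 : (0 < p - 1)%R by rewrite subr_gt0.
rewrite /DpM /Lloc hoelder_conjugate_gt1//.
have e0 : (0 < p / (p - 1))%R by exact: divr_gt0.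
have mf r : measurable_fun setT (((fun x => v x `^ (- p^-1)) \* \1_(ball x0 r))%R : borelType X -> R).
  apply: measurable_funM; first exact: (measurableT_comp (measurable_powR _)).
  by apply: measurable_indic; exact: measurable_metric_ball.
have E r : \int[mu]_x (`|((v x `^ (- p^-1)) * \1_(ball x0 r) x)%:E| `^ (p / (p - 1))) =
    \int[mu]_(y in ball x0 r) (v y `^ (- (p - 1)^-1))%:E.
  rewrite [RHS]integral_mkcond; apply: eq_integral => x _.
  rewrite patchE indicE; case: ifPn => _ /=; last first.
    by rewrite mulr0 normr0 powR0// gt_eqF.
  rewrite mulr1 ger0_norm ?powR_ge0// -powRrM; congr (_ `^ _)%:E.
  by field; rewrite !gt_eqF.
split=> h r r0.
  have /andP[_] := h r r0; rewrite inE /finite_norm unlock => /lty_poweRy.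
  by rewrite E; apply; rewrite invr_eq0 gt_eqF.
apply/andP; split; first by rewrite inE; exact: mf.
by rewrite inE /finite_norm unlock; apply: poweR_lty; rewrite E; exact: h.
Qed.

Lemma DpM_eq1P : DpM mu x0 1 v <-> forall r, (0 < r)%R ->
  exists K : R, \forall x \ae mu, ball x0 r x -> ((v x)^-1 <= K)%R.
Proof.
rewrite /DpM /Lloc hoelder_conjugate1 invr1.
have mf r : measurable_fun setT (((fun x => v x `^ (-1)) \* \1_(ball x0 r))%R : borelType X -> R).
  apply: measurable_funM; first exact: (measurableT_comp (measurable_powR _)).
  by apply: measurable_indic; exact: measurable_metric_ball.
(* The norm of exponent [+oo] is the essential supremum only on a space of positive measure. *)
have mu0 : 0 < mu [set: borelType X].
  apply: (@lt_le_trans _ _ (mu (ball x0 1%R))).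
    by have /andP[] := dmms_ball hX x0 ltr01.
  by apply: le_measure; rewrite ?inE//; exact: measurable_metric_ball.
split=> h r r0.
  have /andP[_] := h r r0; rewrite inE /finite_norm unlock mu0 /=; set S := (X in X < _) => esy.
  have [K SK] : exists K : R, S <= K%:E.
    by case: (S) esy => [k _|//|_]; [exists k|exists 0%R; rewrite leNye].
  exists K; move/ess_supP: SK; apply: filterS => x /= + xr.
  by rewrite lee_fin indicE mem_set// mulr1 ger0_norm ?powR_ge0// powR_inv1// ltW.
apply/andP; split; first by rewrite inE; exact: mf.
rewrite inE /finite_norm unlock mu0.
(* Outside the ball the cut-off function is 0, hence the maximum with 0. *)
have [K hK] := h r r0; apply: (@le_lt_trans _ _ (Num.max K 0)%:E); last exact: ltry.
apply/ess_supP; have := hK; apply: filterS; first exact: (ae_filter_ringOfSetsType mu).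
move=> x /= hx; rewrite lee_fin le_max.
rewrite indicE; case: (boolP (x \in _)); rewrite ?inE => xr.
  by rewrite mulr1 ger0_norm ?powR_ge0// powR_inv1 ?hx// ltW.
by rewrite mulr0 normr0 lexx orbT.
Qed.

Lemma strong_type_weight (p : R) : (1 < p)%R ->
  (forall r, (0 < r)%R -> \int[mu]_(y in ball x0 r) (v y `^ (- (p - 1)^-1))%:E < +oo) ->
  exists2 u, weight mu u &
    maps_into (wLnorm mu p v) (wLnorm mu p u) (local_maximal mu rho).
Proof.
move=> p1 vi; have p0 : (0 < p)%R by exact: lt_trans p1.
have q0 : (0 < p - 1)%R by rewrite subr_gt0.
pose s x := (v x `^ (- (p - 1)^-1))%R.
have s0 x : (0 < s x)%R by exact: powR_gt0.
have ms : measurable_fun setT s by exact: (measurableT_comp (measurable_powR _)).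
have mMs := measurable_local_maximal hX rho0 ms.
(* Where the maximal function is infinite, [fine] returns 0 and [H] is 1; [Msy] shows that this set
   is null. *)
pose H x := Num.max 1%R (fine (local_maximal mu rho s x)).
have H1 x : (1 <= H x)%R by rewrite le_max lexx.
have H0 x : (0 < H x)%R by exact: lt_le_trans (H1 x).
have mH : measurable_fun setT H.
  by apply: measurable_maxr => //; exact: measurableT_comp.
have Msy : mu [set x | local_maximal mu rho s x = +oo] = 0.
  apply: (local_maximal_lty_ae hX (x0 := x0)) => // r r0.
  under eq_integral do rewrite gee0_abs ?lee_fin ?(ltW (s0 _))//.
  exact: vi.
have sH : mu [set x | (H x)%:E < local_maximal mu rho s x] = 0.
  apply: (@subset_measure0 _ _ _ _ _ [set x | local_maximal mu rho s x = +oo]).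
  - by apply: measurable_set_lt => //; exact/measurable_EFinP.
  - by rewrite -[X in measurable X]setTI; exact: (mMs measurableT _ (emeasurable_set1 +oo)).
  - move=> x /=; rewrite /H; have := local_maximal_ge0 mu s x rho0.
    case: (local_maximal mu rho s x) => [r| |]//= _.
    by rewrite lte_fin gt_max ltxx andbF.
  - exact: Msy.
have [C C0 HC] := weak_type_local_maximal hX.
have [K HK] := @sublinear_interpolation _ _ _ mu (local_maximal mu rho)
  (fun f x => local_maximal_ge0 mu f x rho0)
  (fun f => measurable_local_maximal hX rho0)
  (fun t f g h x => @local_maximal_le_add R X mu rho t f g h x)
  C C0 (fun l f => HC rho l f rho0) p s H p1 ms mH s0 H1 sH.
pose u x := (H x `^ (- p))%R.
have measurable_u : measurable_fun setT u by exact: (measurableT_comp (measurable_powR _)).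
exists u.
  apply: weight_of_bounded => // x; rewrite powR_gt0//= /u powRN invf_le1 ?powR_gt0//.
  by rewrite -[leLHS](powRr0 (H x)) ler_powR// ltW.
have K0 : (0 <= Num.max K 0)%R by rewrite le_max lexx orbT.
exists (Num.max K 0 `^ p^-1)%R => f mf _.
split; first exact: measurable_local_maximal.
rewrite /wLnorm -poweR_EFin -poweRM ?lee_fin//; last first.
  by apply: integral_ge0 => x _; rewrite mule_ge0 ?poweR_ge0// lee_fin ltW.
apply: ge0_le_poweR; first by rewrite invr_ge0 ltW.
  by apply: integral_ge0 => x _; rewrite mule_ge0 ?poweR_ge0// lee_fin powR_ge0.
under eq_integral do rewrite (gee0_abs (local_maximal_ge0 mu _ _ rho0)).
apply: (le_trans (HK f mf)).
(* The choice of [s] gives [s ^ (-(p-1)) = v]. *)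
have -> : \int[mu]_x (`|f x| `^ p * s x `^ (- (p - 1)))%:E =
    \int[mu]_x (`|(EFin \o f) x| `^ p * (v x)%:E).
  apply: eq_integral => x _; rewrite /= -EFinM; congr (_ * _)%:E.
  by rewrite /s -powRrM mulrNN mulVf ?gt_eqF// powRr1// ltW.
apply: lee_wpmul2r; last by rewrite lee_fin le_max lexx.
by apply: integral_ge0 => x _; rewrite mule_ge0 ?poweR_ge0// lee_fin ltW.
Qed.

End maximal_weights.

(** * The weight for [p = 1] *)

Section weak_type_weights.
Context (R : realType) (X : pmetricType R).
Variable mu : {measure set (borelType X) -> \bar R}.
Hypothesis hX : doubling_metric_measure_space mu.
Local Open Scope ereal_scope.

(** The function is constant on the annuli [n <= mdist x0 x < n + 1], so preimages are countable
    unions of annuli. *)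
Lemma measurable_mdist_index (x0 : X) (c : nat -> R) :
  measurable_fun setT ((fun x => c (Num.truncn (mdist x0 x))) : borelType X -> R).
Proof.
move=> _ Y mY; rewrite setTI.
rewrite (_ : _ @^-1` _ = \bigcup_(n in [set n | Y (c n)])
  (ball x0 n.+1%:R `\` ball x0 n%:R)).
  apply: bigcup_measurable => n _.
  by apply: measurableD; exact: measurable_metric_ball.
apply/seteqP; split => [x /= Yx|x [n /= Yn [/ball_mdistP xn nx]]].
  exists (Num.truncn (mdist x0 x)) => //; have := truncn_itv (mdist_ge0 x0 x).
  move=> /andP[h1 h2]; split; first exact/ball_mdistP.
  by move/ball_mdistP; rewrite ltNge h1.
rewrite /= (_ : Num.truncn _ = n)//; apply: truncn_def; rewrite xn andbT leNgt.
by apply/negP => h; apply: nx; exact/ball_mdistP.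
Qed.

(** On the [n]-th annulus only the values of [f] in the ball of radius [r n] matter, and there
    [|f| <= K n * |f| * v] almost everywhere. The factor [c n] cancels [K n] and makes the bounds
    summable. *)
Lemma weak_type_weight (x0 : X) (rho : R) (v : borelType X -> R) : (0 < rho)%R ->
  measurable_fun setT v -> (forall x, (0 < v x)%R) ->
  (forall r, (0 < r)%R -> exists K : R,
     \forall x \ae mu, ball x0 r x -> ((v x)^-1 <= K)%R) ->
  exists2 u, weight mu u &
    maps_into (wLnorm mu 1 v) (weak_wLnorm mu 1 u) (local_maximal mu rho).
Proof.
move=> rho0 mv v0 vK.
pose r n : R := (n.+1%:R + rho)%R.
have r0 n : (0 < r n)%R by rewrite addr_gt0.
have [K HK] : exists K : nat -> R, forall n, (1 <= K n)%R /\
    \forall x \ae mu, ball x0 (r n) x -> ((v x)^-1 <= K n)%R.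
  have /choice[K HK] n := vK (r n) (r0 n).
  (* Bounds of at least 1 give [c n <= 1], hence [u <= 1]. *)
  exists (fun n => Num.max 1 (K n))%R => n; split; first by rewrite le_max lexx.
  have := HK n; apply: filterS; first exact: (ae_filter_ringOfSetsType mu).
  by move=> x /= h /h hx; rewrite le_max hx orbT.
have K1 n : (1 <= K n)%R by have [] := HK n.
have K0 n : (0 < K n)%R by exact: lt_le_trans (K1 n).
pose c n : R := ((2 ^ n.+1)%:R^-1 / K n)%R.
have c0 n : (0 < c n)%R by rewrite divr_gt0// invr_gt0 ltr0n expn_gt0.
pose N (x : borelType X) := Num.truncn (mdist x0 x).
pose u (x : borelType X) := c (N x).
have measurable_u : measurable_fun setT u by exact: measurable_mdist_index.
exists u.
  apply: weight_of_bounded => // x; rewrite c0/=.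
  by rewrite ler_pdivrMr// mul1r (le_trans _ (K1 _))// invf_le1 ?ler1n ?ltr0n expn_gt0.
have [C C0 HC] := weak_type_local_maximal hX.
exists C => f mf; rewrite /wLnorm invr1 poweRe1; last first.
  by apply: integral_ge0 => x _; rewrite mule_ge0 ?poweR_ge0// lee_fin ltW.
set J := integral _ _ _ => Jy; split; first exact: measurable_local_maximal.
have J0 : 0 <= J.
  by apply: integral_ge0 => x _; rewrite mule_ge0 ?poweR_ge0// lee_fin ltW.
have JF : J \is a fin_num by rewrite ge0_fin_numE.
apply: ge_ereal_sup => _ [l /= l0 <-]; rewrite invr1 poweRe1; last first.
  by apply: integral_ge0 => x _; rewrite lee_fin ltW// /u.
under eq_set do rewrite gee0_abs ?local_maximal_ge0//.
pose F n := [set x | l%:E < local_maximal mu rho f x] `&` [set x | N x = n].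
have mE : measurable [set x | l%:E < local_maximal mu rho f x].
  by apply: measurable_set_lt => //; exact: measurable_local_maximal.
have mN n : measurable [set x : borelType X | N x = n].
  (* The annulus is the preimage of 1 under its own indicator function. *)
  have := @measurable_mdist_index x0 (fun k => (k == n)%:R) measurableT [set 1%R] (measurable_set1 _).
  rewrite setTI; congr (measurable _); apply/seteqP; split => x /=.
    by rewrite -/(N x); case: eqVneq => // _ /eqP; rewrite eq_sym oner_eq0.
  by rewrite -/(N x) => ->; rewrite eqxx.
have mF n : measurable (F n) by exact: measurableI.
have EF : [set x | l%:E < local_maximal mu rho f x] = \bigcup_n F n.
  by apply/seteqP; split => [x Ex|x [n _ []]//]; exists (N x).
rewrite EF ge0_integral_bigcup//; last 3 first.
- by apply: measurable_funTS; exact/measurable_EFinP.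
- by move=> x _; rewrite lee_fin ltW// /u.
- by apply/trivIsetP => i j _ _ /eqP ij; apply/seteqP; split => // x [[_ xi] [_ xj]]; apply: ij; rewrite -xi -xj.
rewrite -nneseriesZl; last by move=> n _; apply: integral_ge0 => x _; rewrite lee_fin ltW// /u.
have CJ0 : (0 <= C * fine J)%R by rewrite mulr_ge0 ?fine_ge0// ltW.
rewrite -(fineK JF) -EFinM; apply: (le_trans _ (epsilon_trick0 xpredT CJ0)).
apply: lee_nneseries => [n _ _|n _].
  by rewrite mule_ge0 ?lee_fin ?(ltW l0)// integral_ge0// => x _; rewrite lee_fin ltW// /u.
have -> : \int[mu]_(x in F n) (u x)%:E = (c n)%:E * mu (F n).
  rewrite -integral_cst//; apply: eq_integral => x; rewrite inE => -[_ /= xn].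
  by rewrite /u xn.
pose B : set (borelType X) := ball x0 (r n).
have mB : measurable B by exact: measurable_metric_ball.
pose fn := (f \* \1_B)%R : borelType X -> R.
have mfn : measurable_fun setT fn by apply: measurable_funM => //; exact: measurable_indic.
have Fle : l%:E * mu (F n) <= (C * (K n * fine J))%:E.
  apply: (@le_trans _ _ (C%:E * \int[mu]_x `|(fn x)%:E|)).
    apply: le_trans (HC rho l fn rho0 l0 mfn); rewrite lee_pmul2l//.
    apply: le_measure; rewrite ?inE//.
      by apply: measurable_set_lt => //; exact: measurable_local_maximal.
    move=> x [/= lx xn]; rewrite -local_maximal_localize//.
    by rewrite /r lerD2r -xn ltW// truncnS_gt.
  rewrite [leRHS]EFinM lee_pmul2l// EFinM (fineK JF) /J -ge0_integralZl//; last 3 first.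
  - apply: emeasurable_funM; last exact/measurable_EFinP.
    apply: (measurableT_comp (measurable_poweR _)); exact: measurable_abse_EFin.
  - by move=> x _; rewrite mule_ge0 ?poweR_ge0// lee_fin ltW.
  - by rewrite lee_fin ltW.
  apply: ae_ge0_le_integral => //.
  - exact: measurable_abse_EFin.
  - by move=> x _; rewrite !mule_ge0 ?poweR_ge0// lee_fin ltW.
  - apply: measurable_funeM; apply: emeasurable_funM; last exact/measurable_EFinP.
    apply: (measurableT_comp (measurable_poweR _)); exact: measurable_abse_EFin.
  have [_] := HK n; apply: filterS; first exact: (ae_filter_ringOfSetsType mu).
  move=> x /= hx _; rewrite powRr1// -!EFinM lee_fin /fn /= indicE.
  case: (boolP (x \in B)); rewrite ?inE => xB; last first.
    by rewrite mulr0 normr0 !mulr_ge0// ltW.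
  rewrite mulr1 mulrCA ler_peMr// -ler_pdivrMr// mul1r; exact: hx.
rewrite muleCA; apply: (@le_trans _ _ ((c n)%:E * (C * (K n * fine J))%:E)).
  by rewrite lee_wpmul2l// lee_fin ltW.
rewrite -EFinM lee_fin /c le_eqVlt; apply/orP; left; apply/eqP.
by field; rewrite pnatr_eq0 -lt0n expn_gt0 (gt_eqF (K0 n)).
Qed.

End weak_type_weights.

(** * Necessity: testing the weak inequality for [average mu rho] *)

Section necessity.
Context (R : realType) (X : pmetricType R).
Variable mu : {measure set (borelType X) -> \bar R}.
Hypothesis hX : doubling_metric_measure_space mu.
Local Open Scope ereal_scope.

(** A nonnegative function of integral 0 vanishes almost everywhere, which a positive one cannot do
    on a set of positive measure. *)
Lemma integral_weight_gt0 (u : borelType X -> R) (B : set (borelType X)) :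
  measurable B -> measurable_fun setT u -> (forall x, (0 < u x)%R) ->
  0 < mu B -> 0 < \int[mu]_(x in B) (u x)%:E.
Proof.
move=> mB measurable_u u0 B0; rewrite lt_neqAle integral_ge0 ?andbT; last first.
  by move=> x _; rewrite lee_fin ltW.
apply/negP => /eqP/esym I0.
have muB : measurable_fun B (EFin \o u) by apply: measurable_funTS; exact/measurable_EFinP.
have [+ _] := @ae_eq_integral_abs _ _ _ mu B mB (EFin \o u) muB.
have -> : \int[mu]_(x in B) `|(EFin \o u) x| = 0.
  by rewrite -I0; apply: eq_integral => x _; rewrite gee0_abs// lee_fin ltW.
move=> /(_ erefl)[Z [mZ Z0 BZ]]; move: B0; rewrite (subset_measure0 mB mZ _ Z0) ?ltxx//.
move=> x Bx; apply: BZ => /= /(_ Bx)/eqP; rewrite eqe => /eqP ux.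
by have := u0 x; rewrite ux ltxx.
Qed.

(** For [x] in [B = ball y b], the ball [ball x rho] contains [B] and lies in [ball y (2 * rho)].
    Hence the average at [x] is at least the integral of [|f|] over [B] divided by [m2], and [B]
    lies in every level set below that value. *)
Lemma average_testing (rho p b : R) (v u : borelType X -> R) (y : X) :
  (0 < p)%R -> (0 < b <= rho / 2)%R -> (forall x, (0 <= v x)%R) -> weight mu u ->
  maps_into (wLnorm mu p v) (weak_wLnorm mu p u) (average mu rho) ->
  exists2 K : R, (0 <= K)%R & forall f, measurable_fun setT f ->
    wLnorm mu p v (EFin \o f) < +oo ->
    \int[mu]_(x in ball y b) `|(f x)%:E| <= K%:E * wLnorm mu p v (EFin \o f).
Proof.
move=> p0 /andP[b0 brho] v0 [u0 measurable_u _] [C HC].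
have rho0 : (0 < rho)%R by lra.
pose B : set (borelType X) := ball y b.
have mB : measurable B by exact: measurable_metric_ball.
have I0 : 0 < \int[mu]_(x in B) (u x)%:E.
  by apply: integral_weight_gt0 => //; have /andP[] := dmms_ball hX y b0.
(* A positive real below the [u]-mass of [B], whether that mass is finite or not. *)
have [m m0 mI] := lt_EFin_dense I0.
pose m2 := fine (mu (ball y (2 * rho)%R)).
have m20 : (0 < m2)%R by apply: mu_ball_gt0 => //; lra.
have m2E : mu (ball y (2 * rho)%R) = m2%:E by rewrite fineK// mu_ball_fin_num.
pose C' := Num.max C 0%R; have C'0 : (0 <= C')%R by rewrite le_max lexx orbT.
have mp0 : (0 < m `^ p^-1)%R by exact: powR_gt0.
exists (m2 * C' / m `^ p^-1)%R; first by rewrite !mulr_ge0 ?invr_ge0 ?(ltW m20) ?(ltW mp0).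
move=> f mf Ny; have [_ Nle] := HC f mf Ny.
set A := wLnorm _ _ _ _ in Ny Nle *.
have A0 : 0 <= A by exact: poweR_ge0.
have AF : A \is a fin_num by rewrite ge0_fin_numE.
rewrite -(fineK AF) -EFinM leNgt; apply/negP => /lt_EFin_dense[z Az zI].
have z0 : (0 < z)%R.
  apply: le_lt_trans Az; rewrite !mulr_ge0 ?invr_ge0 ?fine_ge0 ?(ltW m20) ?(ltW mp0)//.
have lz : (0 < z / m2)%R by exact: divr_gt0.
have BE : B `<=` [set x | (z / m2)%:E < `|average mu rho f x|].
  move=> x /ball_mdistP yx /=; rewrite gee0_abs ?average_ge0// lt_average//.
  have mBx := @measurable_metric_ball R X x rho.
  apply: (@le_lt_trans _ _ z%:E).
    rewrite (_ : z%:E = (z / m2)%:E * m2%:E); last by rewrite -EFinM divfK// gt_eqF.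
    rewrite -m2E lee_pmul2l//.
    apply: le_measure; rewrite ?inE//; first exact: measurable_metric_ball.
    by apply: subset_ball_mdist; lra.
  apply: (lt_le_trans zI); apply: ge0_subset_integral => //.
    by apply: measurable_funTS; exact: measurable_abse_EFin.
  by apply: subset_ball_mdist; rewrite metric_sym; lra.
have mE : measurable [set x | (z / m2)%:E < `|average mu rho f x|].
  apply: measurable_set_lt => //; apply: measurableT_comp => //.
  exact: measurable_average.
have : (z / m2)%:E * (m `^ p^-1)%:E <= C'%:E * A.
  apply: (@le_trans _ _ (weak_wLnorm mu p u (average mu rho f))); last first.
    by apply: (le_trans Nle); apply: lee_wpmul2r => //; rewrite lee_fin le_max lexx.
  apply: (@le_trans _ _ ((z / m2)%:E *
      (\int[mu]_(x in [set x | (z / m2)%:E < `|average mu rho f x|]) (u x)%:E) `^ p^-1)).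
    rewrite lee_pmul2l// -poweR_EFin; apply: ge0_le_poweR.
    - by rewrite invr_ge0 ltW.
    - by rewrite lee_fin ltW.
    - apply: (le_trans (ltW mI)); apply: ge0_subset_integral => //.
        by apply: measurable_funTS; exact/measurable_EFinP.
      by move=> x _; rewrite lee_fin ltW.
  by apply: ereal_sup_ubound; exists (z / m2)%R.
rewrite -(fineK AF) -!EFinM lee_fin => h.
move: Az; rewrite ltNge => /negP; apply.
rewrite mulrAC ler_pdivlMr// -[leRHS]mulrA -ler_pdivrMl//.
by rewrite mulrA (mulrC _^-1)%R.
Qed.

(** Passes from the balls of one small radius, where testing works, to arbitrary balls around
    [x0]. *)
Lemma ball_cover_ind (x0 : X) (r b : R) (P : set X -> Prop) :
  (0 < r)%R -> (0 < b)%R -> P set0 ->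
  (forall A B : set X, open A -> open B -> P A -> P B -> P (A `|` B)) ->
  (forall A B : set X, open A -> open B -> A `<=` B -> P B -> P A) ->
  (forall y, P (ball y b)) -> P (ball x0 r).
Proof.
move=> r0 b0 P0 PU PS Pb.
(* The radius is [b / 2], since the cover consists of balls of twice the given radius. *)
have [t tr] := ball_finite_cover hX x0 r0 (divr_gt0 b0 (ltr0Sn R 1)).
have oU (s : seq X) : open (\bigcup_(y in [set` s]) ball y b).
  by apply: bigcup_open => y _; exact: metric_ball_open.
apply: (PS _ (\bigcup_(y in [set` t]) ball y b)) => //; first exact: metric_ball_open.
  by move: tr; rewrite mulrC divfK.
elim: t {tr} => [|y t IH]; first by rewrite set_nil bigcup_set0.
rewrite (_ : \bigcup_(_ in _) _ = ball y b `|` \bigcup_(z in [set` t]) ball z b).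
  by apply: PU => //; exact: metric_ball_open.
apply/seteqP; split => [x [z /=]|x [yx|[z /= zt zx]]].
- by rewrite inE => /orP[/eqP -> yx|zt zx]; [left|right; exists z].
- by exists y => //=; rewrite mem_head.
- by exists z => //=; rewrite inE zt orbT.
Qed.

(** Since [s ^ p * v = s], testing with [s] restricted to a set gives [I <= K * I ^ (1/p)] for the
    integral [I] of [s] over that set, so [I <= K ^ (p/(p-1))] as soon as [I] is finite. *)
Lemma necessity_gt1 (x0 : X) (rho p : R) (v u : borelType X -> R) :
  (0 < rho)%R -> (1 < p)%R -> measurable_fun setT v -> (forall x, (0 < v x)%R) ->
  weight mu u ->
  maps_into (wLnorm mu p v) (weak_wLnorm mu p u) (average mu rho) ->
  forall r, (0 < r)%R -> \int[mu]_(y in ball x0 r) (v y `^ (- (p - 1)^-1))%:E < +oo.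
Proof.
move=> rho0 p1 mv v0 wu Tb r r0; have p0 : (0 < p)%R by exact: lt_trans p1.
have q0 : (0 < p - 1)%R by rewrite subr_gt0.
pose s x := (v x `^ (- (p - 1)^-1))%R.
have s0 x : (0 < s x)%R by exact: powR_gt0.
have ms : measurable_fun setT s by exact: (measurableT_comp (measurable_powR _)).
have mEs (A : set (borelType X)) : measurable_fun A (EFin \o s).
  by apply: measurable_funTS; exact/measurable_EFinP.
have sge0 x : 0 <= (s x)%:E by rewrite lee_fin ltW.
have spv x : (s x `^ p * v x = s x)%R.
  rewrite -(mulr_powRB1 (ltW (s0 x)) p0) /s -[in X in (_ * X * _)%R]powRrM mulNr.
  by rewrite mulVf ?gt_eqF// powR_inv1 ?ltW// -mulrA mulVf ?mulr1// gt_eqF.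
apply: (@ball_cover_ind x0 r (rho / 2)%R (fun A => \int[mu]_(y in (A : set (borelType X))) (s y)%:E < +oo)) => //.
- by rewrite divr_gt0.
- by rewrite integral_set0.
- move=> A B oA oB hA hB; have mA := measurable_open oA; have mB := measurable_open oB.
  rewrite -(setDUK (@subsetUl _ A B)) setDUl setDv set0U.
  have mD := measurableD mB mA.
  rewrite ge0_integral_setU//; last by apply/disj_setPS => x [Ax [_ /(_ Ax)]].
  apply: lte_add_pinfty => //; apply: le_lt_trans hB.
  by apply: ge0_subset_integral => // x [].
- move=> A B oA oB AB; apply: le_lt_trans.
  by apply: ge0_subset_integral => //; exact: measurable_open.
move=> y; have brho : (0 < rho / 2 <= rho / 2)%R by rewrite divr_gt0/=.
have [K K0 HK] := average_testing y p0 brho (fun x => ltW (v0 x)) wu Tb.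
pose B : set (borelType X) := ball y (rho / 2).
have mB : measurable B by exact: measurable_metric_ball.
(* Bounding [s] by [n] makes [I] finite, and the resulting bound is uniform in [n]. *)
pose F (n : nat) : set (borelType X) := B `&` [set x | (s x <= n%:R)%R].
have mF n : measurable (F n).
  apply: measurableI => //; rewrite -[X in measurable X]setTI.
  rewrite (_ : [set x | _] = s @^-1` `]-oo, n%:R]); first exact: (ms measurableT).
  by apply/seteqP; split => x /=; rewrite in_itv.
have UF : \bigcup_n F n = B.
  apply/seteqP; split => [x [n _ []]//|x Bx]; exists (Num.truncn (s x)).+1 => //.
  by split => //=; rewrite ltW// truncnS_gt.
have nd : nondecreasing_seq F.
  move=> i j ij; rewrite subsetEset => x [Bx /= xi]; split => //=.
  by rewrite (le_trans xi)// ler_nat.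
have cv : \int[mu]_(x in F n) (s x)%:E @[n --> \oo] --> \int[mu]_(x in \bigcup_n F n) (s x)%:E.
  by apply: (ge0_nondecreasing_set_cvg_integral nd) => // n; exact: mEs.
rewrite -[X in integral _ X _]UF -(cvg_lim _ cv)//.
apply: (@le_lt_trans _ _ (K `^ (p / (p - 1)))%:E); last exact: ltry.
apply: lime_le; first by apply/cvg_ex; eexists; exact: cv.
apply: nearW => n; set I := integral _ _ _.
have I0 : 0 <= I by exact: integral_ge0.
have Iy : I < +oo.
  apply: (@le_lt_trans _ _ (\int[mu]_(x in F n) (cst n%:R%:E x))).
    by apply: ge0_le_integral => // x [].
  rewrite integral_cst// lte_mul_pinfty// ?lee_fin//.
  apply: (@le_lt_trans _ _ (mu B)); first by apply: le_measure; rewrite ?inE//; exact: subIsetl.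
  by rewrite -ge0_fin_numE// mu_ball_fin_num.
have IF : I \is a fin_num by rewrite ge0_fin_numE.
pose f := (s \* \1_(F n))%R.
have mf : measurable_fun setT f by apply: measurable_funM => //; exact: measurable_indic.
have Nf : wLnorm mu p v (EFin \o f) = I `^ p^-1.
  rewrite /wLnorm /I [in RHS]integral_mkcond; congr (_ `^ _); apply: eq_integral => x _.
  rewrite patchE /f /= indicE; case: ifPn => _.
    by rewrite mulr1 ger0_norm ?(ltW (s0 x))// -EFinM spv.
  by rewrite mulr0 normr0 powR0 ?gt_eqF// mul0e.
have := HK f mf; rewrite Nf => /(_ (poweR_lty _ Iy)).
have -> : \int[mu]_(x in ball y (rho / 2)) `|(f x)%:E| = I.
  rewrite [LHS]integral_mkcond /I [RHS]integral_mkcond; apply: eq_integral => x _.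
  rewrite !patchE /f /= indicE; case: (boolP (x \in F n)) => xF; last first.
    by rewrite mulr0 normr0 if_same.
  rewrite mulr1 ger0_norm ?(ltW (s0 x))// ifT//.
  by move: xF; rewrite !inE => -[].
rewrite -(fineK IF) poweR_EFin -EFinM !lee_fin.
have : (0 <= fine I)%R by rewrite fine_ge0.
rewrite le_eqVlt => /predU1P[<- _|i0]; first exact: powR_ge0.
move=> iK.
have ip : (fine I `^ ((p - 1) / p) <= K)%R.
  rewrite mulrBl divff ?gt_eqF// mul1r powRB; last by apply/implyP => _; rewrite gt_eqF.
  by rewrite powRr1 ?(ltW i0)// ler_pdivrMr// powR_gt0.
have := ge0_ler_powR (ltW (divr_gt0 p0 q0)) _ _ ip.
rewrite !nnegrE powR_ge0 => /(_ isT K0).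
rewrite -powRrM (_ : (p - 1) / p * (p / (p - 1)) = 1)%R ?powRr1 ?(ltW i0)//.
by field; rewrite !gt_eqF.
Qed.

(** Testing with the indicator of the part [E] of a ball where [v < 1/(K+1)] gives
    [mu E <= K/(K+1) * mu E], and [mu E] is finite, so [E] is null. *)
Lemma necessity_eq1 (x0 : X) (rho : R) (v u : borelType X -> R) :
  (0 < rho)%R -> measurable_fun setT v -> (forall x, (0 < v x)%R) ->
  weight mu u ->
  maps_into (wLnorm mu 1 v) (weak_wLnorm mu 1 u) (average mu rho) ->
  forall r, (0 < r)%R -> exists K : R,
    \forall x \ae mu, ball x0 r x -> ((v x)^-1 <= K)%R.
Proof.
move=> rho0 mv v0 wu Tb r r0.
apply: (@ball_cover_ind x0 r (rho / 2)%R (fun A => exists K : R,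
    \forall x \ae mu, A x -> ((v x)^-1 <= K)%R)) => //.
- by rewrite divr_gt0.
- by exists 0%R; exact: aeW.
- move=> A B _ _ [K1 h1] [K2 h2]; exists (Num.max K1 K2).
  have := h2; have := h1; apply: filterS2; first exact: (ae_filter_ringOfSetsType mu).
  by move=> x /= k1 k2 [/k1|/k2] h; rewrite le_max h ?orbT.
- move=> A B _ _ AB [K h]; exists K; have := h; apply: filterS.
    exact: (ae_filter_ringOfSetsType mu).
  by move=> x /= h' /AB.
move=> y; have brho : (0 < rho / 2 <= rho / 2)%R by rewrite divr_gt0/=.
have [K K0 HK] := average_testing y ltr01 brho (fun x => ltW (v0 x)) wu Tb.
(* With [K + 1] in place of [K] the factor is strictly below 1, and the inverse makes sense even for
   [K = 0]. *)
exists (K + 1)%R; have K10 : (0 < K + 1)%R by rewrite ltr_wpDl.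
pose B : set (borelType X) := ball y (rho / 2).
have mB : measurable B by exact: measurable_metric_ball.
pose E : set (borelType X) := B `&` [set x | (v x < (K + 1)^-1)%R].
have mE : measurable E.
  apply: measurableI => //.
  apply: (measurable_set_lt (F := EFin \o v) (G := cst ((K + 1)^-1)%R%:E)) => //.
  exact/measurable_EFinP.
have EF : mu E \is a fin_num.
  rewrite ge0_fin_numE//; apply: (@le_lt_trans _ _ (mu B)).
    by apply: le_measure; rewrite ?inE//; exact: subIsetl.
  by rewrite -ge0_fin_numE// mu_ball_fin_num.
have mf : measurable_fun setT (\1_E : borelType X -> R) by exact: measurable_indic.
have Nf : wLnorm mu 1 v (EFin \o \1_E) <= ((K + 1)^-1)%:E * mu E.
  rewrite /wLnorm invr1 poweRe1; last first.
    by apply: integral_ge0 => x _; rewrite mule_ge0 ?poweR_ge0// lee_fin ltW.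
  rewrite -integral_cst// [leRHS]integral_mkcond; apply: ge0_le_integral => //.
  - by move=> x _; rewrite mule_ge0 ?poweR_ge0// lee_fin ltW.
  - apply: emeasurable_funM; last exact/measurable_EFinP.
    apply: (measurableT_comp (measurable_poweR _)); exact: measurable_abse_EFin.
  - by apply: (measurable_restrictT _ mE).1; exact: measurable_cst.
  move=> x _; rewrite patchE /= indicE; case: (boolP (x \in E)); rewrite ?inE => xE.
    by rewrite normr1 powR1 mul1e lee_fin ltW//; case: xE.
  by rewrite normr0 powR0 ?oner_eq0// mul0e.
have := HK _ mf; have -> : \int[mu]_(x in ball y (rho / 2)) `|(\1_E x)%:E| = mu E.
  under eq_integral do rewrite gee0_abs ?lee_fin//.
  by rewrite integral_indic// setIidl//; exact: subIsetl.
have Ny : ((K + 1)^-1)%:E * mu E < +oo by rewrite -(fineK EF) -EFinM ltry.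
move=> /(_ (le_lt_trans Nf Ny)) h.
have {}h : mu E <= K%:E * (((K + 1)^-1)%:E * mu E).
  by apply: (le_trans h); rewrite lee_wpmul2l.
have E0 : mu E = 0.
  apply/eqP; rewrite eq_le measure_ge0 andbT; move: h; rewrite -(fineK EF) -!EFinM !lee_fin.
  have e0 : (0 <= fine (mu E))%R by rewrite fine_ge0.
  by rewrite mulrA mulrAC ler_pdivlMr// mulrDr mulr1 (mulrC K) gerDl.
exists E; split => // x /= /not_implyP[Bx /negP]; rewrite -ltNge => vx; split => //=.
by rewrite -[ltLHS]invrK ltf_pV2 ?posrE ?invr_gt0.
Qed.

End necessity.

Theorem proposition2p1 (R : realType) (X : pmetricType R) (x0 : X)
    (mu : {measure set (borelType X) -> \bar R})
    (rho p : R) (v : borelType X -> R)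
    (hX : doubling_metric_measure_space mu)
    (hrho : 0 < rho) (hp : 1 <= p) (hv : weight mu v) :
  (DpM mu x0 p v ->
   exists u : borelType X -> R, [/\ weight mu u,
     1 < p -> maps_into (wLnorm mu p v) (wLnorm mu p u)
                        (local_maximal mu rho) &
     p = 1 -> maps_into (wLnorm mu 1 v) (weak_wLnorm mu 1 u)
                        (local_maximal mu rho)])
  /\
  ((forall r : R, 0 < r -> (\int[mu]_(x in ball x0 r) (v x)%:E < +oo)%E) ->
   (exists u : borelType X -> R, weight mu u /\
     maps_into (wLnorm mu p v) (weak_wLnorm mu p u) (average mu rho)) ->
   DpM mu x0 p v).
Proof.
have [v0 mv _] := hv.
have [p1|p1] := ltP 1 p.
  split => [/(DpM_gt1P mu x0 mv p1) vi|_ [u [wu Tb]]].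
    have [u wu Tu] := strong_type_weight hX hrho mv v0 p1 vi.
    exists u; split => // pE; by rewrite pE ltxx in p1.
  by apply/(DpM_gt1P mu x0 mv p1); exact: (necessity_gt1 hX x0 hrho p1 mv v0 wu Tb).
have -> : p = 1 by apply/eqP; rewrite eq_le p1.
split => [/(DpM_eq1P hX x0 mv v0) vK|_ [u [wu Tb]]].
  have [u wu Tu] := weak_type_weight hX hrho mv v0 vK.
  by exists u; split => //; rewrite ltxx.
by apply/(DpM_eq1P hX x0 mv v0); exact: (necessity_eq1 hX x0 hrho mv v0 wu Tb).
Qed.
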